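(* Let $k$ be an algebraically closed field of characteristic zero and let $A_4$ be the alternating group on four letters. The group $\mathrm{H}^2_\ell(A_4)$ has order two.
   Context: For a finite group $G$, $k[G]$ is the group algebra with coproduct $\Delta(g)=g\otimes g$ for $g\in G$. A twist on $k[G]$ is an invertible element $F\in k[G]\otimes k[G]$ with $(F\otimes 1)(\Delta\otimes\mathrm{id})(F)=(1\otimes F)(\mathrm{id}\otimes\Delta)(F)$. It is invariant if $\Delta(a)F=F\Delta(a)$ for all $a\in k[G]$. Invariant twists form a group $Z^2$ under multiplication. For $a$ in the group $A^1$ of invertible central elements of $k[G]$ put $\delta^1(a)=(a\otimes a)\Delta(a^{-1})$; $\delta^1$ is a homomorphism onto a central subgroup of $Z^2$, and $\mathrm{H}^2_\ell(G)=Z^2/\delta^1(A^1)$. *)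

(* Defs.v *)
From HB Require Import structures.
From mathcomp Require Import all_boot all_order all_algebra all_fingroup.
From mathcomp Require Import all_solvable.
From mathcomp Require Import generic_quotient.
From mathcomp Require Import boolp classical_sets functions cardinality.

Set Implicit Arguments.
Unset Strict Implicit.
Unset Printing Implicit Defensive.

Import GRing.Theory.
Local Open Scope ring_scope.

(* The group algebra k[G]: functions G -> k under convolution. The alias keeps
   this product apart from the pointwise one on {ffun gT -> k}. *)
Definition galg (k : fieldType) (gT : finGroupType) : Type := {ffun gT -> k}.

HB.instance Definition _ (k : fieldType) (gT : finGroupType) :=
  GRing.Lmodule.copy (galg k gT) {ffun gT -> k^o}.

Section GroupAlgebra.
Variables (k : fieldType) (gT : finGroupType).
Implicit Types (a b c : galg k gT) (g h : gT).

Definition gcoef a g : k := (a : {ffun gT -> k}) g.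

Lemma galgP a b : (forall g, gcoef a g = gcoef b g) <-> a = b.
Proof. by split=> [ab|->//]; apply/ffunP => g; exact: ab. Qed.

Definition gbasis g : galg k gT := [ffun h => (h == g)%:R].

Definition gmul a b : galg k gT :=
  [ffun g => \sum_h gcoef a h * gcoef b (h^-1 * g)%g].

Lemma gcoefD a b g : gcoef (a + b) g = gcoef a g + gcoef b g.
Proof. by rewrite /gcoef ffunE. Qed.

Lemma gcoefZ (x : k) a g : gcoef (x *: a) g = x * gcoef a g.
Proof. by rewrite /gcoef ffunE. Qed.

Lemma gcoef_basis g h : gcoef (gbasis g) h = (h == g)%:R.
Proof. by rewrite /gcoef ffunE. Qed.

Lemma gcoef_mul a b g :
  gcoef (gmul a b) g = \sum_h gcoef a h * gcoef b (h^-1 * g)%g.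
Proof. by rewrite /gcoef ffunE. Qed.

Fact gmulA : associative gmul.
Proof.
move=> a b c; apply/galgP => g; rewrite !gcoef_mul.
under eq_bigr do rewrite gcoef_mul mulr_sumr.
under [RHS]eq_bigr do rewrite gcoef_mul mulr_suml.
rewrite [RHS]exchange_big; apply: eq_bigr => h _ /=.
rewrite [RHS](reindex_inj (mulgI h)); apply: eq_bigr => l _ /=.
by rewrite mulKg invMg mulrA mulgA.
Qed.

Fact gmul1g : left_id (gbasis 1%g) gmul.
Proof.
move=> a; apply/galgP => g; rewrite gcoef_mul (bigD1 1%g) //= gcoef_basis eqxx.
rewrite big1 => [|h /negPf h1]; last by rewrite gcoef_basis h1 mul0r.
by rewrite mul1r addr0 invg1 mul1g.
Qed.

Fact gmulg1 : right_id (gbasis 1%g) gmul.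
Proof.
move=> a; apply/galgP => g; rewrite gcoef_mul (bigD1 g) //= gcoef_basis mulVg.
rewrite eqxx big1 => [|h hg]; first by rewrite mulr1 addr0.
by rewrite gcoef_basis -eq_mulVg1 (negPf hg) mulr0.
Qed.

Fact gmulDl : left_distributive gmul +%R.
Proof.
move=> a b c; apply/galgP => g; rewrite gcoefD !gcoef_mul -big_split.
by apply: eq_bigr => h _; rewrite gcoefD mulrDl.
Qed.

Fact gmulDr : right_distributive gmul +%R.
Proof.
move=> a b c; apply/galgP => g; rewrite gcoefD !gcoef_mul -big_split.
by apply: eq_bigr => h _; rewrite gcoefD mulrDr.
Qed.

Fact gbasis1_neq0 : gbasis 1%g != 0.
Proof.
apply/eqP => /galgP/(_ 1%g); rewrite gcoef_basis eqxx /gcoef ffunE.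
by move/eqP; rewrite oner_eq0.
Qed.

HB.instance Definition _ := GRing.Zmodule_isNzRing.Build (galg k gT)
  gmulA gmul1g gmulg1 gmulDl gmulDr gbasis1_neq0.

Fact gscaleAl (x : k) a b : x *: (a * b) = (x *: a) * b.
Proof.
apply/galgP => g; rewrite gcoefZ !gcoef_mul mulr_sumr.
by apply: eq_bigr => h _; rewrite gcoefZ mulrA.
Qed.

HB.instance Definition _ := GRing.Lmodule_isLalgebra.Build k (galg k gT)
  gscaleAl.

Fact gscaleAr (x : k) a b : x *: (a * b) = a * (x *: b).
Proof.
apply/galgP => g; rewrite gcoefZ !gcoef_mul mulr_sumr.
by apply: eq_bigr => h _; rewrite gcoefZ mulrCA.
Qed.

HB.instance Definition _ := GRing.Lalgebra_isAlgebra.Build k (galg k gT)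
  gscaleAr.

(* Units are the elements with a two-sided inverse, picked by choice. *)
Definition gunit : pred (galg k gT) :=
  fun a => `[< exists b, b * a = 1 /\ a * b = 1 >].

Definition ginv a : galg k gT :=
  match pselect (exists b, b * a = 1 /\ a * b = 1) with
  | left e => projT1 (cid e)
  | right _ => a
  end.

Fact gmulVr : {in gunit, left_inverse 1 ginv *%R}.
Proof.
by move=> a /asboolP ua; rewrite /ginv; case: pselect => // e; case: cid => ? [].
Qed.

Fact gmulrV : {in gunit, right_inverse 1 ginv *%R}.
Proof.
by move=> a /asboolP ua; rewrite /ginv; case: pselect => // e; case: cid => ? [].
Qed.

Fact gunitP a b : b * a = 1 /\ a * b = 1 -> gunit a.
Proof. by move=> ab; apply/asboolP; exists b. Qed.

Fact ginv_out : {in [predC gunit], ginv =1 id}.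
Proof.
move=> a; rewrite inE => /negP ua; rewrite /ginv; case: pselect => // e.
by case: ua; apply/asboolP.
Qed.

HB.instance Definition _ := GRing.NzRing_hasMulInverse.Build (galg k gT)
  gmulVr gmulrV gunitP ginv_out.

Lemma gcoefM a b g :
  gcoef (a * b) g = \sum_h gcoef a h * gcoef b (h^-1 * g)%g.
Proof. exact: gcoef_mul. Qed.

Lemma gbasis1 : gbasis 1%g = 1.
Proof. by []. Qed.

Lemma gbasisM g h : gbasis (g * h)%g = gbasis g * gbasis h.
Proof.
apply/galgP => l; rewrite gcoefM (bigD1 g) //= big1 => [|m /negPf mg].
  by rewrite !gcoef_basis eqxx mul1r addr0 -[in RHS](inj_eq (mulgI g)) mulKVg.
by rewrite gcoef_basis mg mul0r.
Qed.

Lemma galg_sum a : a = \sum_g gcoef a g *: gbasis g.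
Proof.
apply/galgP => h; rewrite {2}/gcoef sum_ffunE (bigD1 h) //= big1 => [|g gh].
  by rewrite !ffunE eqxx [_ *: _]mulr1 addr0.
by rewrite !ffunE eq_sym (negPf gh) [_ *: _]mulr0.
Qed.

(* The linear map k[G] -> V sending the basis vector g to v g. *)
Definition glift (V : lmodType k) (v : gT -> V) a : V :=
  \sum_g gcoef a g *: v g.

Fact glift_linear (V : lmodType k) (v : gT -> V) : linear (glift v).
Proof.
move=> x a b; rewrite /glift scaler_sumr -big_split; apply: eq_bigr => g _.
by rewrite gcoefD gcoefZ scalerDl scalerA.
Qed.

HB.instance Definition _ (V : lmodType k) (v : gT -> V) :=
  GRing.isLinear.Build k (galg k gT) V *:%R (glift v) (glift_linear v).

Lemma glift_basis (V : lmodType k) (v : gT -> V) g : glift v (gbasis g) = v g.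
Proof.
rewrite /glift (bigD1 g) //= big1 => [|h /negPf hg].
  by rewrite gcoef_basis eqxx scale1r addr0.
by rewrite gcoef_basis hg scale0r.
Qed.

Lemma glift1 (B : algType k) (v : gT -> B) : v 1%g = 1 -> glift v 1 = 1.
Proof. by move=> v1; rewrite -gbasis1 glift_basis. Qed.

Lemma gliftM (B : algType k) (v : gT -> B) :
    (forall g h, v (g * h)%g = v g * v h) ->
  {morph glift v : a b / a * b}.
Proof.
move=> vM a b; rewrite {1}[a]galg_sum {1}[b]galg_sum mulr_suml raddf_sum.
rewrite /= [in RHS]/glift mulr_suml; apply: eq_bigr => g _.
rewrite mulr_sumr raddf_sum /= mulr_sumr; apply: eq_bigr => h _.
by rewrite -!scalerAl -!scalerAr !linearZ /= -gbasisM glift_basis vM !scalerA mulrC.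
Qed.

End GroupAlgebra.

Section Tensor.
Variables (k : fieldType) (gT1 gT2 : finGroupType).

(* k[G1] (x) k[G2] is realised as k[G1 x G2], with g (x) h the basis vector of
   the pair (g, h). *)
Definition tensor (a : galg k gT1) (b : galg k gT2)
    : galg k (gT1 * gT2)%type :=
  [ffun x => gcoef a x.1 * gcoef b x.2].

Lemma gcoef_tensor a b x : gcoef (tensor a b) x = gcoef a x.1 * gcoef b x.2.
Proof. by rewrite /gcoef ffunE. Qed.

Lemma tensor_basis g h : tensor (gbasis k g) (gbasis k h) = gbasis k (g, h).
Proof.
apply/galgP => -[x y]; rewrite gcoef_tensor !gcoef_basis /= xpair_eqE.
by rewrite -natrM mulnb.
Qed.

Lemma tensorM a a' b b' :
  tensor (a * a') (b * b') = tensor a b * tensor a' b'.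
Proof.
apply/galgP => x; rewrite gcoef_tensor !gcoefM.
transitivity (\sum_g \sum_h gcoef (tensor a b) (g, h) *
  gcoef (tensor a' b') ((g, h)^-1 * x)%g).
  rewrite mulr_suml; apply: eq_bigr => g _.
  rewrite mulr_sumr; apply: eq_bigr => h _.
  by rewrite !gcoef_tensor /= mulrACA.
by rewrite pair_bigA; apply: eq_bigr => -[].
Qed.

Lemma tensor1 : tensor 1 1 = 1.
Proof. exact: tensor_basis. Qed.

Lemma tensor_linear_l x (a a' : galg k gT1) (b : galg k gT2) :
  tensor (x *: a + a') b = x *: tensor a b + tensor a' b.
Proof.
apply/galgP => y.
by rewrite gcoefD gcoefZ !gcoef_tensor gcoefD gcoefZ mulrDl mulrA.
Qed.

Lemma tensor_linear_r x (a : galg k gT1) (b b' : galg k gT2) :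
  tensor a (x *: b + b') = x *: tensor a b + tensor a b'.
Proof.
apply/galgP => y.
by rewrite gcoefD gcoefZ !gcoef_tensor gcoefD gcoefZ mulrDr mulrCA.
Qed.

End Tensor.

(* f1 (x) f2, for linear f1 and f2: f1 and f2 are bare functions, but only
   their values on the bases are used. *)
Definition tensor_map (k : fieldType) (gT1 gT2 hT1 hT2 : finGroupType)
    (f1 : galg k gT1 -> galg k hT1) (f2 : galg k gT2 -> galg k hT2)
    : galg k (gT1 * gT2)%type -> galg k (hT1 * hT2)%type :=
  glift (fun x => tensor (f1 (gbasis k x.1)) (f2 (gbasis k x.2))).

(* The associativity isomorphism g (x) (h (x) l) |-> (g (x) h) (x) l. *)
Definition tensor_assoc (k : fieldType) (gT1 gT2 gT3 : finGroupType)
    : galg k (gT1 * (gT2 * gT3))%type -> galg k ((gT1 * gT2) * gT3)%type :=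
  glift (fun x => gbasis k ((x.1, x.2.1), x.2.2)).

Lemma glift_ext (k : fieldType) (gT : finGroupType) (V : lmodType k)
    (f h : galg k gT -> V) :
  linear f -> linear h -> (forall g, f (gbasis k g) = h (gbasis k g)) ->
  f =1 h.
Proof.
move=> lf lh fh a; rewrite [a]galg_sum.
pose f' : {linear galg k gT -> V} := HB.pack f
  (GRing.isLinear.Build k (galg k gT) V *:%R f lf).
pose h' : {linear galg k gT -> V} := HB.pack h
  (GRing.isLinear.Build k (galg k gT) V *:%R h lh).
rewrite -[f _]/(f' _) -[h _]/(h' _) !linear_sum; apply: eq_bigr => g _.
by rewrite !linearZ /= fh.
Qed.

Section TensorMaps.
Variables (k : fieldType) (gT1 gT2 gT3 hT1 hT2 : finGroupType).

Lemma tensor_mapE (f1 : {linear galg k gT1 -> galg k hT1})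
    (f2 : {linear galg k gT2 -> galg k hT2}) a b :
  tensor_map f1 f2 (tensor a b) = tensor (f1 a) (f2 b).
Proof.
pose lhs a b := tensor_map f1 f2 (tensor a b).
pose rhs a b := tensor (f1 a) (f2 b).
apply: (glift_ext (f := lhs^~ b) (h := rhs^~ b)) a => [x a a'|x a a'|g].
- by rewrite /lhs /= tensor_linear_l /tensor_map linearP.
- by rewrite /rhs /= linearP tensor_linear_l.
apply: (glift_ext (f := lhs _) (h := rhs _)) b => [x b b'|x b b'|h].
- by rewrite /lhs /= tensor_linear_r /tensor_map linearP.
- by rewrite /rhs /= linearP tensor_linear_r.
by rewrite /lhs /rhs tensor_basis /tensor_map glift_basis.
Qed.

Lemma tensor_assocE (a : galg k gT1) (b : galg k gT2) (c : galg k gT3) :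
  tensor_assoc (tensor a (tensor b c)) = tensor (tensor a b) c.
Proof.
pose lhs (a : galg k gT1) (b : galg k gT2) (c : galg k gT3) :=
  tensor_assoc (tensor a (tensor b c)).
pose rhs (a : galg k gT1) (b : galg k gT2) (c : galg k gT3) :=
  tensor (tensor a b) c.
rewrite -[LHS]/(lhs a b c) -[RHS]/(rhs a b c).
apply: (glift_ext (f := fun a => lhs a b c) (h := fun a => rhs a b c)) a
  => [x a a'|x a a'|g].
- by rewrite /lhs /= tensor_linear_l /tensor_assoc linearP.
- by rewrite /rhs /= !tensor_linear_l.
apply: (glift_ext (f := fun b => lhs _ b c) (h := fun b => rhs _ b c)) b
  => [x b b'|x b b'|h].
- by rewrite /lhs /= tensor_linear_l tensor_linear_r /tensor_assoc linearP.
- by rewrite /rhs /= tensor_linear_r tensor_linear_l.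
apply: (glift_ext (f := lhs _ _) (h := rhs _ _)) c => [x c c'|x c c'|l].
- by rewrite /lhs /= !tensor_linear_r /tensor_assoc linearP.
- by rewrite /rhs /= tensor_linear_r.
by rewrite /lhs /rhs !tensor_basis /tensor_assoc glift_basis.
Qed.

End TensorMaps.

Section Twists.
Variables (k : fieldType) (gT : finGroupType).
Local Notation kG := (galg k gT).
Local Notation kG2 := (galg k (gT * gT)%type).
Local Notation kG3 := (galg k ((gT * gT) * gT)%type).

Definition coproduct : kG -> kG2 :=
  glift (fun g => tensor (gbasis k g) (gbasis k g)).

Definition is_twist (F : kG2) : Prop :=
  F \is a GRing.unit /\
  tensor F (1 : kG) * tensor_map coproduct (@id kG) F =
    tensor_assoc (tensor (1 : kG) F) *
    tensor_assoc (tensor_map (@id kG) coproduct F) :> kG3.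

Definition is_invariant (F : kG2) : Prop :=
  forall a : kG, coproduct a * F = F * coproduct a.

Definition is_central (a : kG) : Prop := forall b : kG, a * b = b * a.

(* Membership is wrapped in asbool so that A1 and Z2 are subtypes. *)
Record A1 : Type := MkA1 {
  A1_val : kG;
  A1_subproof : `[< A1_val \is a GRing.unit /\ is_central A1_val >] }.

HB.instance Definition _ := [isSub for A1_val].
HB.instance Definition _ := [Choice of A1 by <:].

Record Z2 : Type := MkZ2 {
  Z2_val : kG2;
  Z2_subproof : `[< is_twist Z2_val /\ is_invariant Z2_val >] }.

HB.instance Definition _ := [isSub for Z2_val].
HB.instance Definition _ := [Choice of Z2 by <:].

Lemma A1P (a : A1) : A1_val a \is a GRing.unit /\ is_central (A1_val a).
Proof. by case: a => a /= /asboolP. Qed.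

Lemma Z2P (F : Z2) : is_twist (Z2_val F) /\ is_invariant (Z2_val F).
Proof. by case: F => F /= /asboolP. Qed.

Fact A1_one_subproof : `[< (1 : kG) \is a GRing.unit /\ is_central 1 >].
Proof.
by apply/asboolP; split=> [|b]; rewrite ?unitr1 // mul1r mulr1.
Qed.

Fact A1_mul_subproof (a b : A1) :
  `[< A1_val a * A1_val b \is a GRing.unit /\
      is_central (A1_val a * A1_val b) >].
Proof.
have [ua ca] := A1P a; have [ub cb] := A1P b.
apply/asboolP; split=> [|c]; first by rewrite unitrMl.
by rewrite -mulrA cb mulrA ca -mulrA.
Qed.

Fact A1_inv_subproof (a : A1) :
  `[< (A1_val a)^-1 \is a GRing.unit /\ is_central (A1_val a)^-1 >].
Proof.
have [ua ca] := A1P a; apply/asboolP; split=> [|c]; first by rewrite unitrV.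
by apply/esym/commrV.
Qed.

Definition A1_one := MkA1 A1_one_subproof.
Definition A1_mul (a b : A1) := MkA1 (A1_mul_subproof a b).
Definition A1_inv (a : A1) := MkA1 (A1_inv_subproof a).

Fact A1_mulA : associative A1_mul.
Proof. by move=> a b c; apply: val_inj; rewrite /= mulrA. Qed.
Fact A1_mul1 : left_id A1_one A1_mul.
Proof. by move=> a; apply: val_inj; rewrite /= mul1r. Qed.
Fact A1_mulr1 : right_id A1_one A1_mul.
Proof. by move=> a; apply: val_inj; rewrite /= mulr1. Qed.
Fact A1_mulV : left_inverse A1_one A1_inv A1_mul.
Proof.
by move=> a; apply: val_inj; rewrite /= mulVr //; case: (A1P a).
Qed.
Fact A1_mulrV : right_inverse A1_one A1_inv A1_mul.
Proof.
by move=> a; apply: val_inj; rewrite /= divrr //; case: (A1P a).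
Qed.

HB.instance Definition _ :=
  isGroup.Build A1 A1_mulA A1_mul1 A1_mulr1 A1_mulV A1_mulrV.

Lemma coproduct1 : coproduct 1 = 1.
Proof. by apply: glift1; rewrite gbasis1 tensor1. Qed.

Lemma coproductM : {morph coproduct : a b / a * b}.
Proof. by apply: gliftM => g h; rewrite gbasisM tensorM. Qed.

Definition twL (F : kG2) : kG3 := tensor F 1.
Definition twR (F : kG2) : kG3 := tensor_assoc (tensor (1 : kG) F).
Definition cpL (F : kG2) : kG3 := tensor_map coproduct (@id kG) F.
Definition cpR (F : kG2) : kG3 :=
  tensor_assoc (tensor_map (@id kG) coproduct F).

Lemma tensor_assocM : {morph @tensor_assoc k gT gT gT : a b / a * b}.
Proof. by apply: gliftM => g h; rewrite -gbasisM. Qed.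

Lemma tensor_assoc1 : @tensor_assoc k gT gT gT 1 = 1.
Proof. exact: glift1. Qed.

Lemma twLM : {morph twL : a b / a * b}.
Proof. by move=> a b; rewrite /twL -tensorM mulr1. Qed.

Lemma twL1 : twL 1 = 1. Proof. exact: tensor1. Qed.

Lemma twRM : {morph twR : a b / a * b}.
Proof. by move=> a b; rewrite /twR -tensor_assocM -tensorM mulr1. Qed.

Lemma twR1 : twR 1 = 1.
Proof. by rewrite /twR tensor1 tensor_assoc1. Qed.

Lemma cpLM : {morph cpL : a b / a * b}.
Proof.
by apply: gliftM => x y; rewrite !gbasisM coproductM tensorM.
Qed.

Lemma cpL1 : cpL 1 = 1.
Proof. by apply: glift1; rewrite !gbasis1 coproduct1 tensor1. Qed.

Lemma cpRM : {morph cpR : a b / a * b}.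
Proof.
move=> a b; rewrite /cpR -tensor_assocM; congr tensor_assoc.
by apply: gliftM => x y; rewrite !gbasisM coproductM tensorM.
Qed.

Lemma cpR1 : cpR 1 = 1.
Proof.
rewrite /cpR -[RHS]tensor_assoc1; congr tensor_assoc.
by apply: glift1; rewrite !gbasis1 coproduct1 tensor1.
Qed.

Lemma cpLcoproduct (a : kG) : cpL (coproduct a) = cpR (coproduct a).
Proof.
have lin : linear coproduct by exact: linearP.
apply: (glift_ext (f := cpL \o coproduct) (h := cpR \o coproduct)) a
    => [x a b|x a b|g] /=.
- by rewrite lin /cpL /tensor_map linearP.
- by rewrite lin /cpR /tensor_map /tensor_assoc !linearP.
rewrite /coproduct glift_basis tensor_basis /cpL /cpR /tensor_map.
rewrite !glift_basis /= /coproduct glift_basis !tensor_basis.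
by rewrite /tensor_assoc glift_basis.
Qed.

Lemma cpL_tensor (a b : kG) : cpL (tensor a b) = tensor (coproduct a) b.
Proof.
exact: (tensor_mapE (@glift k gT kG2 _ : {linear kG -> kG2})
  (idfun : {linear kG -> kG})).
Qed.

Lemma cpR_tensor (a b : kG) :
  cpR (tensor a b) = tensor_assoc (tensor a (coproduct b)).
Proof.
congr tensor_assoc.
exact: (tensor_mapE (idfun : {linear kG -> kG})
  (@glift k gT kG2 _ : {linear kG -> kG2})).
Qed.

Fact Z2_one_subproof : `[< is_twist (1 : kG2) /\ is_invariant (1 : kG2) >].
Proof.
apply/asboolP; split=> [|a]; last by rewrite mulr1 mul1r.
split; first exact: unitr1.
by rewrite -/(twL _) -/(twR _) -/(cpL _) -/(cpR _) twL1 twR1 cpL1 cpR1.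
Qed.

Lemma invariant_comm (F F' : kG2) : is_invariant F ->
  twL F * cpL F' = cpL F' * twL F /\ twR F * cpR F' = cpR F' * twR F.
Proof.
move=> iF; split.
- apply: (glift_ext (f := fun u => twL F * cpL u) (h := fun u => cpL u * twL F))
    => [x u v|x u v|[g h]]; rewrite ?[cpL (_ + _)]linearP.
  + by rewrite mulrDr scalerAr.
  + by rewrite mulrDl scalerAl.
  by rewrite -tensor_basis cpL_tensor /twL -!tensorM -iF mulr1 mul1r.
- apply: (glift_ext (f := fun u => twR F * cpR u) (h := fun u => cpR u * twR F))
    => [x u v|x u v|[g h]]; rewrite ?[cpR _]/cpR /tensor_map ?[glift _ _]linearP
      /tensor_assoc ?[glift _ (_ + _)]linearP.
  + by rewrite mulrDr scalerAr.
  + by rewrite mulrDl scalerAl.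
  rewrite -/(tensor_map _ _ _) -/(tensor_assoc _) -/(cpR _) -tensor_basis.
  rewrite cpR_tensor /twR -!tensor_assocM -!tensorM.
  by rewrite -iF mulr1 mul1r.
Qed.

Fact Z2_mul_subproof (F F' : Z2) :
  `[< is_twist (Z2_val F * Z2_val F') /\
      is_invariant (Z2_val F * Z2_val F') >].
Proof.
have [[uF tF] iF] := Z2P F; have [[uF' tF'] iF'] := Z2P F'.
apply/asboolP; split=> [|a]; last by rewrite mulrA iF -mulrA iF' mulrA.
split; first by rewrite unitrMl.
move: tF tF'; rewrite -![tensor _ 1]/(twL _) -![tensor_assoc (tensor 1 _)]/(twR _).
rewrite -![tensor_map coproduct _ _]/(cpL _).
rewrite -![tensor_assoc (tensor_map _ _ _)]/(cpR _) twLM twRM cpLM cpRM => tF tF'.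
have [cL _] := invariant_comm (Z2_val F) iF'.
have [_ cR] := invariant_comm (Z2_val F) iF'.
rewrite !mulrA -(mulrA (twL (Z2_val F)) (twL _)) cL mulrA tF.
rewrite -(mulrA _ (twL (Z2_val F'))) tF'.
by rewrite -(mulrA (twR (Z2_val F)) (twR _)) cR !mulrA.
Qed.

Fact Z2_inv_subproof (F : Z2) :
  `[< is_twist (Z2_val F)^-1 /\ is_invariant (Z2_val F)^-1 >].
Proof.
have [[uF tF] iF] := Z2P F.
apply/asboolP; split=> [|a]; last exact/commrV.
split; first by rewrite unitrV.
have [cL cR] := invariant_comm (Z2_val F) iF.
move: tF; rewrite -![tensor _ 1]/(twL _) -![tensor_assoc (tensor 1 _)]/(twR _).
rewrite -![tensor_map coproduct _ _]/(cpL _).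
rewrite -![tensor_assoc (tensor_map _ _ _)]/(cpR _) => tF.
have inv_morph (f : kG2 -> kG3) : {morph f : a b / a * b} -> f 1 = 1 ->
    f (Z2_val F) \is a GRing.unit /\ f (Z2_val F)^-1 = (f (Z2_val F))^-1.
  move=> fM f1; have fVf : f (Z2_val F)^-1 * f (Z2_val F) = 1.
    by rewrite -fM mulVr.
  have ffV : f (Z2_val F) * f (Z2_val F)^-1 = 1 by rewrite -fM mulrV.
  have uf : f (Z2_val F) \is a GRing.unit by apply/unitrP; exists (f (Z2_val F)^-1).
  by split=> //; apply: (mulrI uf); rewrite mulrV.
have [uL ->] := inv_morph _ twLM twL1; have [uR ->] := inv_morph _ twRM twR1.
have [vL ->] := inv_morph _ cpLM cpL1; have [vR ->] := inv_morph _ cpRM cpR1.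
by rewrite -!invrM // -cL tF cR.
Qed.

Definition Z2_one := MkZ2 Z2_one_subproof.
Definition Z2_mul (F F' : Z2) := MkZ2 (Z2_mul_subproof F F').
Definition Z2_inv (F : Z2) := MkZ2 (Z2_inv_subproof F).

Fact Z2_mulA : associative Z2_mul.
Proof. by move=> a b c; apply: val_inj; rewrite /= mulrA. Qed.
Fact Z2_mul1 : left_id Z2_one Z2_mul.
Proof. by move=> a; apply: val_inj; rewrite /= mul1r. Qed.
Fact Z2_mulr1 : right_id Z2_one Z2_mul.
Proof. by move=> a; apply: val_inj; rewrite /= mulr1. Qed.
Fact Z2_mulV : left_inverse Z2_one Z2_inv Z2_mul.
Proof.
by move=> a; apply: val_inj; rewrite /= mulVr //; case: (Z2P a) => -[].
Qed.
Fact Z2_mulrV : right_inverse Z2_one Z2_inv Z2_mul.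
Proof.
by move=> a; apply: val_inj; rewrite /= divrr //; case: (Z2P a) => -[].
Qed.

HB.instance Definition _ :=
  isGroup.Build Z2 Z2_mulA Z2_mul1 Z2_mulr1 Z2_mulV Z2_mulrV.

Definition delta1_fun (a : kG) : kG2 := tensor a a * coproduct a^-1.

Lemma tensor_unit (a b : kG) : a \is a GRing.unit -> b \is a GRing.unit ->
  tensor a b \is a GRing.unit.
Proof.
move=> ua ub; apply/unitrP; exists (tensor a^-1 b^-1).
by rewrite -!tensorM !mulVr // !mulrV // tensor1.
Qed.

Lemma coproduct_unit (a : kG) : a \is a GRing.unit ->
  coproduct a \is a GRing.unit.
Proof.
move=> ua; apply/unitrP; exists (coproduct a^-1).
by rewrite -!coproductM mulVr // mulrV // coproduct1.
Qed.

Lemma tensor_central (a b : kG) : is_central a -> is_central b ->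
  forall u, tensor a b * u = u * tensor a b.
Proof.
move=> ca cb.
apply: (glift_ext (f := fun u => tensor a b * u) (h := fun u => u * tensor a b))
  => [x u v|x u v|[g h]].
- by rewrite mulrDr scalerAr.
- by rewrite mulrDl scalerAl.
by rewrite -tensor_basis -!tensorM ca cb.
Qed.

Fact delta1_subproof (a : A1) :
  `[< is_twist (delta1_fun (A1_val a)) /\ is_invariant (delta1_fun (A1_val a)) >].
Proof.
have [ua ca] := A1P a; set x := A1_val a in ua ca *.
apply/asboolP; split=> [|b]; last first.
  rewrite /delta1_fun mulrA -(tensor_central ca ca) -!mulrA -!coproductM.
  by congr (_ * coproduct _); apply: commrV; rewrite /GRing.comm ca.
split.
  by rewrite unitrMl ?tensor_unit // coproduct_unit // unitrV.
rewrite -![tensor _ 1]/(twL _) -![tensor_assoc (tensor 1 _)]/(twR _).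
rewrite -![tensor_map coproduct _ _]/(cpL _).
rewrite -![tensor_assoc (tensor_map _ _ _)]/(cpR _).
rewrite /delta1_fun twLM twRM cpLM cpRM cpLcoproduct !mulrA; congr (_ * _).
rewrite -!mulrA cpL_tensor cpR_tensor /twL /twR -!tensor_assocM -!tensorM.
by rewrite -coproductM mulVr // coproduct1 !mulr1 !mul1r tensor_assocE.
Qed.

Definition delta1 (a : A1) : Z2 := MkZ2 (delta1_subproof a).

Fact delta1M : {morph delta1 : a b / (a * b)%g}.
Proof.
move=> a b; apply: val_inj; rewrite /= /delta1_fun.
have [ua ca] := A1P a; have [ub cb] := A1P b.
rewrite invrM // coproductM tensorM -!mulrA; congr (_ * _).
rewrite !mulrA -(tensor_central cb cb) -!mulrA -!coproductM.
by congr (_ * (coproduct _)); apply: commrV; apply/esym/commrV; rewrite /GRing.comm cb.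
Qed.

Lemma delta1_central (a : A1) (F : Z2) : (delta1 a * F = F * delta1 a)%g.
Proof.
have [_ ca] := A1P a; have [_ iF] := Z2P F; apply: val_inj => /=.
by rewrite /delta1_fun -mulrA iF !mulrA -(tensor_central ca ca).
Qed.

Lemma delta1_1 : delta1 1%g = 1%g.
Proof. by apply: (mulgI (delta1 1%g)); rewrite -delta1M !mulg1. Qed.

Lemma delta1V (a : A1) : delta1 a^-1%g = (delta1 a)^-1%g.
Proof. by apply: (mulgI (delta1 a)); rewrite -delta1M !mulgV delta1_1. Qed.

Definition coboundary_eq : rel Z2 :=
  fun F F' => `[< exists a : A1, F' = (F * delta1 a)%g >].

Fact coboundary_eq_refl : reflexive coboundary_eq.
Proof. by move=> F; apply/asboolP; exists 1%g; rewrite delta1_1 mulg1. Qed.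

Fact coboundary_eq_sym : symmetric coboundary_eq.
Proof.
move=> F F'; apply/asboolP/asboolP => -[a ->];
  by exists a^-1%g; rewrite delta1V mulgK.
Qed.

Fact coboundary_eq_trans : transitive coboundary_eq.
Proof.
move=> F' F F'' /asboolP[a ->] /asboolP[b ->]; apply/asboolP.
by exists (a * b)%g; rewrite delta1M mulgA.
Qed.

Canonical coboundary_equiv :=
  EquivRel coboundary_eq coboundary_eq_refl coboundary_eq_sym
    coboundary_eq_trans.

Local Open Scope quotient_scope.

(* delta1(A1) is central, so left and right cosets agree and H2 is a group. *)
Definition H2 : Type := {eq_quot coboundary_equiv}.

HB.instance Definition _ := Choice.on H2.
HB.instance Definition _ := EqQuotient.on H2.

Definition H2_class (F : Z2) : H2 := \pi_H2 F.

Lemma H2_classP (F F' : Z2) :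
  H2_class F = H2_class F' <-> exists a : A1, F' = (F * delta1 a)%g.
Proof.
split=> [/eqmodP/asboolP //|aF].
by apply/eqmodP/asboolP.
Qed.

Lemma H2_ind (P : H2 -> Prop) : (forall F, P (H2_class F)) -> forall x, P x.
Proof. by move=> PF x; rewrite -[x]reprK; exact: PF. Qed.

Definition H2_one : H2 := H2_class 1%g.
Definition H2_mul (x y : H2) : H2 := H2_class (repr x * repr y)%g.
Definition H2_inv (x : H2) : H2 := H2_class (repr x)^-1%g.

Lemma repr_H2_class (F : Z2) :
  exists a : A1, repr (H2_class F) = (F * delta1 a)%g.
Proof. by apply/H2_classP; rewrite /H2_class reprK. Qed.

Lemma H2_classM (F F' : Z2) :
  H2_mul (H2_class F) (H2_class F') = H2_class (F * F')%g.
Proof.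
have [a aE] := repr_H2_class F; have [b bE] := repr_H2_class F'.
apply/esym/H2_classP; exists (a * b)%g; rewrite aE bE delta1M.
by rewrite !mulgA -(mulgA F) delta1_central mulgA.
Qed.

Lemma H2_classV (F : Z2) : H2_inv (H2_class F) = H2_class F^-1%g.
Proof.
have [a aE] := repr_H2_class F; apply/esym/H2_classP; exists a^-1%g.
by rewrite aE -delta1_central invgM delta1V.
Qed.

Fact H2_mulA : associative H2_mul.
Proof.
by elim/H2_ind=> x; elim/H2_ind=> y; elim/H2_ind=> z; rewrite !H2_classM mulgA.
Qed.
Fact H2_mul1 : left_id H2_one H2_mul.
Proof. by elim/H2_ind=> x; rewrite H2_classM mul1g. Qed.
Fact H2_mulr1 : right_id H2_one H2_mul.
Proof. by elim/H2_ind=> x; rewrite H2_classM mulg1. Qed.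
Fact H2_mulV : left_inverse H2_one H2_inv H2_mul.
Proof. by elim/H2_ind=> x; rewrite H2_classV H2_classM mulVg. Qed.
Fact H2_mulrV : right_inverse H2_one H2_inv H2_mul.
Proof. by elim/H2_ind=> x; rewrite H2_classV H2_classM mulgV. Qed.

HB.instance Definition _ :=
  isGroup.Build H2 H2_mulA H2_mul1 H2_mulr1 H2_mulV H2_mulrV.

End Twists.

(* Main.v *)
(* Let V be the Klein four-subgroup of G = A4 and chi a generator of the group
   of linear characters of G. If F is an invariant twist, then (chi (x) id)(F)
   is a central unit, and a Hilbert 90 argument in the centre of k[G] makes it 1
   after multiplying F by a coboundary. Applying chi to the first factor of the
   twist equation then shows that F is fixed by g (x) h |-> chi(g) g (x) h.
   Applying chi to the second and to the third factor shows that (id (x) chi)(F)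
   is central and grouplike, hence 1 because A4 has trivial centre, and that F
   is also fixed by g (x) h |-> chi(h) g (x) h. So F lies in k[V] (x) k[V], and
   its Fourier transform is a 2-cocycle on the dual of V, invariant under an
   automorphism rho of order three. Up to the coboundaries still available there
   are exactly two of these: the trivial one, and a bicharacter with values +-1
   which is not symmetric, while every coboundary is. *)

Require Import Defs.
From HB Require Import structures.
From mathcomp Require Import all_boot all_order all_algebra all_fingroup.
From mathcomp Require Import all_solvable.
From mathcomp Require Import boolp classical_sets functions cardinality.
From mathcomp Require Import ring.

Set Implicit Arguments.
Unset Strict Implicit.
Unset Printing Implicit Defensive.

Import GRing.Theory.

(** * Group algebras *)

Section GroupAlgebraFacts.
Local Open Scope ring_scope.
Variables (k : fieldType) (gT : finGroupType).
Implicit Types (a b : galg k gT) (g h : gT).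

Lemma linear_ext (V : lmodType k) (f1 f2 : {linear galg k gT -> V}) :
  (forall g, f1 (gbasis k g) = f2 (gbasis k g)) -> f1 =1 f2.
Proof. by apply: glift_ext; exact: linearP. Qed.

Lemma gcoef0 g : gcoef (0 : galg k gT) g = 0.
Proof. by rewrite /gcoef ffunE. Qed.

Lemma gcoef_sum (I : Type) (r : seq I) (P : pred I) (F : I -> galg k gT) g :
  gcoef (\sum_(i <- r | P i) F i) g = \sum_(i <- r | P i) gcoef (F i) g.
Proof. exact: sum_ffunE. Qed.

Lemma gcoef_basisMl a g h : gcoef (gbasis k g * a) h = gcoef a (g^-1 * h)%g.
Proof.
rewrite gcoefM (bigD1 g) //= gcoef_basis eqxx mul1r big1 ?addr0 // => l lg.
by rewrite gcoef_basis (negPf lg) mul0r.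
Qed.

Lemma gcoef_basisMr a g h : gcoef (a * gbasis k g) h = gcoef a (h * g^-1)%g.
Proof.
rewrite gcoefM (bigD1 (h * g^-1)%g) //= gcoef_basis invMg invgK mulgKV eqxx.
rewrite mulr1 big1 ?addr0 // => l lg; rewrite gcoef_basis -(inj_eq (mulgI l)).
by rewrite mulKVg -(inj_eq (mulIg (g^-1)%g)) mulgK eq_sym (negPf lg) mulr0.
Qed.

Lemma is_centralP a :
  is_central a <-> forall g h, gcoef a (g * h * g^-1)%g = gcoef a h.
Proof.
split=> [ca g h|aJ b].
  by rewrite -gcoef_basisMr ca gcoef_basisMl !mulgA mulVg mul1g.
suff cb g : a * gbasis k g = gbasis k g * a.
  rewrite [b]galg_sum mulr_sumr mulr_suml; apply: eq_bigr => g _.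
  by rewrite -scalerAr -scalerAl cb.
apply/galgP => h; rewrite gcoef_basisMl gcoef_basisMr -(aJ g (g^-1 * h)%g).
by rewrite mulKVg.
Qed.

Definition functional (chi : gT -> k) : galg k gT -> k :=
  glift (chi : gT -> k^o).
HB.instance Definition _ chi :=
  GRing.Linear.copy (functional chi : _ -> k^o) (glift (chi : gT -> k^o)).

Lemma functional_basis chi g : functional chi (gbasis k g) = chi g.
Proof. exact: (glift_basis (chi : gT -> k^o)). Qed.

Lemma functionalE chi a : functional chi a = \sum_g gcoef a g * chi g.
Proof. by []. Qed.

Lemma functionalZ chi x a : functional chi (x *: a) = x * functional chi a.
Proof. exact: linearZ. Qed.

Lemma functionalD chi a b :
  functional chi (a + b) = functional chi a + functional chi b.
Proof. exact: linearD. Qed.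

(** * Elements supported on a subgroup, and Fourier inversion for them *)

Definition supported (H : {set gT}) a := forall g, g \notin H -> gcoef a g = 0.

Lemma supportedM (H : {group gT}) a b :
  supported H a -> supported H b -> supported H (a * b).
Proof.
move=> Ha Hb g Hg; rewrite gcoefM big1 // => h _.
have [hH|hH] := boolP (h \in H); last by rewrite Ha ?mul0r.
by rewrite Hb ?mulr0 // groupMl ?groupV.
Qed.

Lemma supported1 (H : {group gT}) : supported H 1.
Proof.
move=> g Hg; rewrite -gbasis1 gcoef_basis.
by case: eqP Hg => // ->; rewrite group1.
Qed.

(** Expanding [a] involves only basis vectors from [H], so multiplicativity is asked only for a
    first argument in [H]. This covers characters of a subgroup extended by zero. *)
Lemma functionalM (H : {set gT}) (chi : gT -> k) a b :
    (forall g h, g \in H -> chi (g * h)%g = chi g * chi h) ->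
  supported H a -> functional chi (a * b) = functional chi a * functional chi b.
Proof.
move=> chiM Ha; rewrite {1}[a]galg_sum mulr_suml linear_sum functionalE.
rewrite mulr_suml.
apply: eq_bigr => g _; have [gH|gH] := boolP (g \in H); last first.
  by rewrite Ha // scale0r mul0r linear0 !mul0r.
rewrite -scalerAl linearZ /= -mulrA; congr (_ * _).
rewrite [b]galg_sum mulr_sumr !linear_sum mulr_sumr; apply: eq_bigr => h _.
by rewrite -scalerAr !linearZ /= -gbasisM !functional_basis chiM // mulrCA.
Qed.

(** Fourier inversion: the orthogonality relation recovers the coefficient at [g] as [N^-1] times
    the sum over [i] of [psi i g * functional (psi i) a]. *)
Lemma functional_inj (I : finType) (H : {set gT}) (psi : I -> gT -> k) (N : k)
    a b :
    N != 0 ->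
    (forall g h, g \in H -> h \in H ->
       \sum_i psi i g * psi i h = N * (g == h)%:R) ->
    supported H a -> supported H b ->
  (forall i, functional (psi i) a = functional (psi i) b) -> a = b.
Proof.
move=> N0 psiN Ha Hb ab; apply/galgP => g.
have [gH|gH] := boolP (g \in H); last by rewrite Ha // Hb.
have inv c : supported H c ->
    \sum_i psi i g * functional (psi i) c = N * gcoef c g.
  move=> Hc; under eq_bigr do rewrite functionalE mulr_sumr.
  rewrite exchange_big (bigD1 g) //= [X in _ + X]big1 ?addr0 => [|h hg].
    under eq_bigr do rewrite mulrCA.
    by rewrite -mulr_sumr psiN // eqxx mulr1 mulrC.
  have [hH|hH] := boolP (h \in H).
    under eq_bigr do rewrite mulrCA.
    by rewrite -mulr_sumr psiN // eq_sym (negPf hg) !mulr0.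
  by rewrite big1 // => i _; rewrite Hc // mul0r mulr0.
apply: (mulfI N0); rewrite -!inv //.
by apply: eq_bigr => i _; rewrite ab.
Qed.

(** This is [chi (x) id] after the coproduct. For linear characters these maps are algebra
    automorphisms, and the character group acts through them. *)
Definition tw (chi : gT -> k) : galg k gT -> galg k gT :=
  glift (fun g => chi g *: gbasis k g).
HB.instance Definition _ chi := GRing.Linear.copy (tw chi) (glift _).

Lemma tw_basis chi g : tw chi (gbasis k g) = chi g *: gbasis k g.
Proof. exact: glift_basis. Qed.

Lemma gcoef_tw chi a g : gcoef (tw chi a) g = chi g * gcoef a g.
Proof.
rewrite /tw /glift gcoef_sum (bigD1 g) //= big1 ?addr0 => [|h hg].
  by rewrite !gcoefZ gcoef_basis eqxx mulr1 mulrC.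
by rewrite !gcoefZ gcoef_basis eq_sym (negPf hg) !mulr0.
Qed.

Section Character.
Variable chi : gT -> k.
Hypothesis chiM : forall g h, chi (g * h)%g = chi g * chi h.
Hypothesis chi1 : chi 1%g = 1.

Lemma char_functionalM : {morph functional chi : a b / a * b}.
Proof.
move=> a b; apply: (@functionalM [set: gT]%SET) => // g.
by rewrite inE.
Qed.

Lemma char_functional1 : functional chi 1 = 1.
Proof. by rewrite -gbasis1 functional_basis. Qed.

(** When the group order is invertible in [k], this is the central idempotent attached to the linear
    character [chi]. *)
Definition char_idem : galg k gT := [ffun g => (#|gT|%:R)^-1 * chi (g^-1)%g].

Lemma gcoef_idem g : gcoef char_idem g = #|gT|%:R^-1 * chi (g^-1)%g.
Proof. by rewrite /gcoef ffunE. Qed.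

Lemma basis_idem g : gbasis k g * char_idem = chi g *: char_idem.
Proof.
apply/galgP => h; rewrite gcoef_basisMl gcoefZ !gcoef_idem invMg invgK chiM.
by ring.
Qed.

Lemma mul_idem a : a * char_idem = functional chi a *: char_idem.
Proof.
rewrite {1}[a]galg_sum mulr_suml functionalE scaler_suml.
by apply: eq_bigr => g _; rewrite -scalerAl basis_idem scalerA.
Qed.

Lemma functional_idem : #|gT|%:R != 0 :> k -> functional chi char_idem = 1.
Proof.
move=> n0; rewrite functionalE.
under eq_bigr do rewrite gcoef_idem -mulrA -chiM mulVg chi1 mulr1.
by rewrite sumr_const -[_ *+ _]mulr_natr mulVf.
Qed.

(** Multiplying the idempotent by [g] scales it by [chi g], but scales its value under [psi] by
    [psi g]. As the two scalars differ, the value is zero. *)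
Lemma functional_idem0 (psi : gT -> k) g :
    (forall h, psi (g * h)%g = psi g * psi h) -> psi g != chi g ->
  functional psi char_idem = 0.
Proof.
move=> psiM pg; have: functional psi (gbasis k g * char_idem) =
    psi g * functional psi char_idem.
  (* The basis vector is supported on a single point, where [psi] is multiplicative by
     assumption. *)
  rewrite -(functional_basis psi g); apply: (@functionalM [set g]).
    by move=> ? h /set1P->.
  by move=> h; rewrite inE gcoef_basis => /negPf->.
rewrite basis_idem linearZ /= => /eqP; rewrite -subr_eq0 -mulrBl mulf_eq0.
by rewrite subr_eq0 eq_sym (negPf pg) => /eqP.
Qed.

Lemma idem_central : is_central char_idem.
Proof.
apply/is_centralP => g h; rewrite !gcoef_idem !invMg invgK !chiM.
by congr (_ * _); rewrite mulrCA -chiM mulgV chi1 mulr1.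
Qed.

End Character.
End GroupAlgebraFacts.

(** * Evaluating twists at linear characters *)

Section PartialEvaluation.
Local Open Scope ring_scope.
Variables (k : fieldType) (gT : finGroupType).
Local Notation kG := (galg k gT).
Local Notation kG2 := (galg k (gT * gT)%type).
Local Notation kG3 := (galg k ((gT * gT) * gT)%type).
Implicit Types (a b : kG) (F : kG2) (g h : gT).

HB.instance Definition _ := GRing.Linear.copy (@coproduct k gT) (glift _).

Fact twL_linear : linear (@twL k gT).
Proof. by move=> x a b; rewrite /twL tensor_linear_l. Qed.
HB.instance Definition _ :=
  GRing.isLinear.Build k kG2 kG3 *:%R (@twL k gT) twL_linear.

Fact twR_linear : linear (@twR k gT).
Proof.
by move=> x a b; rewrite /twR tensor_linear_r /tensor_assoc linearP.
Qed.
HB.instance Definition _ :=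
  GRing.isLinear.Build k kG2 kG3 *:%R (@twR k gT) twR_linear.

HB.instance Definition _ := GRing.Linear.copy (@cpL k gT) (glift _).

Fact cpR_linear : linear (@cpR k gT).
Proof.
by move=> x a b; rewrite /cpR /tensor_map /tensor_assoc !linearP.
Qed.
HB.instance Definition _ :=
  GRing.isLinear.Build k kG2 kG3 *:%R (@cpR k gT) cpR_linear.

Definition tensl a : kG2 := tensor a 1.
Definition tensr a : kG2 := tensor 1 a.

Fact tensl_linear : linear tensl.
Proof. by move=> x a b; rewrite /tensl tensor_linear_l. Qed.
HB.instance Definition _ :=
  GRing.isLinear.Build k kG kG2 *:%R tensl tensl_linear.

Fact tensr_linear : linear tensr.
Proof. by move=> x a b; rewrite /tensr tensor_linear_r. Qed.
HB.instance Definition _ :=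
  GRing.isLinear.Build k kG kG2 *:%R tensr tensr_linear.

Lemma tensl_basis g : tensl (gbasis k g) = gbasis k (g, 1%g).
Proof. exact: tensor_basis. Qed.

Lemma tensr_basis g : tensr (gbasis k g) = gbasis k (1%g, g).
Proof. exact: tensor_basis. Qed.

Lemma coproduct_basis g : coproduct (gbasis k g) = gbasis k (g, g).
Proof. by rewrite /coproduct glift_basis tensor_basis. Qed.

Lemma twL_basis (p : gT * gT) : twL (gbasis k p) = gbasis k (p, 1%g).
Proof. exact: tensor_basis. Qed.

Lemma twR_basis (p : gT * gT) : twR (gbasis k p) = gbasis k ((1%g, p.1), p.2).
Proof. by rewrite /twR tensor_basis /tensor_assoc glift_basis. Qed.

Lemma cpL_basis (p : gT * gT) : cpL (gbasis k p) = gbasis k ((p.1, p.1), p.2).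
Proof.
by rewrite /cpL /tensor_map glift_basis coproduct_basis tensor_basis.
Qed.

Lemma cpR_basis (p : gT * gT) : cpR (gbasis k p) = gbasis k ((p.1, p.2), p.2).
Proof.
rewrite /cpR /tensor_map glift_basis coproduct_basis tensor_basis.
by rewrite /tensor_assoc glift_basis.
Qed.

Lemma is_twistP F :
  is_twist F <-> F \is a GRing.unit /\ twL F * cpL F = twR F * cpR F.
Proof. by []. Qed.

Lemma tensorE a b : tensor a b = tensl a * tensr b.
Proof. by rewrite /tensl /tensr -tensorM mulr1 mul1r. Qed.

Lemma tensr_tensl a b : tensr b * tensl a = tensor a b.
Proof. by rewrite /tensl /tensr -tensorM mulr1 mul1r. Qed.

Lemma is_invariantP F : is_invariant F <->
  forall g x y,
    gcoef F (g * x * g^-1, g * y * g^-1)%g = gcoef F (x, y).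
Proof.
split=> [iF g x y|iF a].
  have := congr1 (fun u => gcoef u (g * x, g * y)%g) (iF (gbasis k g)).
  by rewrite /= coproduct_basis gcoef_basisMl gcoef_basisMr /=
    -[(_ * _)%g]/(_, _) -[RHS]/(gcoef F (_, _)) /= !mulKg => ->.
suff cF g : coproduct (gbasis k g) * F = F * coproduct (gbasis k g).
  rewrite [a]galg_sum linear_sum mulr_sumr mulr_suml; apply: eq_bigr => g _.
  by rewrite linearZ /= -scalerAr -scalerAl cF.
apply/galgP => -[x y]; rewrite coproduct_basis gcoef_basisMl gcoef_basisMr.
rewrite -[LHS]/(gcoef F (g^-1 * x, g^-1 * y)%g).
rewrite -[RHS]/(gcoef F (x * g^-1, y * g^-1)%g).
by rewrite -(iF g (g^-1 * x)%g) !mulKVg.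
Qed.

(** * Contraction of tensor legs with a linear character *)

Definition evl (chi : gT -> k) : kG2 -> kG :=
  glift (fun p => chi p.1 *: gbasis k p.2).
Definition evr (chi : gT -> k) : kG2 -> kG :=
  glift (fun p => chi p.2 *: gbasis k p.1).
HB.instance Definition _ chi := GRing.Linear.copy (evl chi) (glift _).
HB.instance Definition _ chi := GRing.Linear.copy (evr chi) (glift _).

Definition ev1 (chi : gT -> k) : kG3 -> kG2 :=
  glift (fun p => chi p.1.1 *: gbasis k (p.1.2, p.2)).
Definition ev2 (chi : gT -> k) : kG3 -> kG2 :=
  glift (fun p => chi p.1.2 *: gbasis k (p.1.1, p.2)).
Definition ev3 (chi : gT -> k) : kG3 -> kG2 :=
  glift (fun p => chi p.2 *: gbasis k p.1).
HB.instance Definition _ chi := GRing.Linear.copy (ev1 chi) (glift _).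
HB.instance Definition _ chi := GRing.Linear.copy (ev2 chi) (glift _).
HB.instance Definition _ chi := GRing.Linear.copy (ev3 chi) (glift _).

Definition twl (chi : gT -> k) : kG2 -> kG2 := tw (fun p => chi p.1).
Definition twr (chi : gT -> k) : kG2 -> kG2 := tw (fun p => chi p.2).
HB.instance Definition _ chi := GRing.Linear.copy (twl chi) (glift _).
HB.instance Definition _ chi := GRing.Linear.copy (twr chi) (glift _).

Section Character.
Variable chi : gT -> k.
Hypothesis chiM : forall g h, chi (g * h)%g = chi g * chi h.
Hypothesis chi1 : chi 1%g = 1.

Let basisZM (hT : finGroupType) (x y : k) (p q : hT) :
  (x * y) *: gbasis k (p * q)%g = (x *: gbasis k p) * (y *: gbasis k q).
Proof. by rewrite gbasisM -scalerAl -scalerAr scalerA. Qed.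

Lemma evlM : {morph evl chi : a b / a * b}.
Proof. by apply: gliftM => p q; rewrite -basisZM -chiM. Qed.
Lemma evrM : {morph evr chi : a b / a * b}.
Proof. by apply: gliftM => p q; rewrite -basisZM -chiM. Qed.
Lemma ev1M : {morph ev1 chi : a b / a * b}.
Proof. by apply: gliftM => p q; rewrite -basisZM -chiM. Qed.
Lemma ev2M : {morph ev2 chi : a b / a * b}.
Proof. by apply: gliftM => p q; rewrite -basisZM -chiM. Qed.
Lemma ev3M : {morph ev3 chi : a b / a * b}.
Proof. by apply: gliftM => -[p1 p2] [q1 q2]; rewrite -basisZM -chiM. Qed.

Lemma evl1 : evl chi 1 = 1.
Proof. by apply: glift1; rewrite /= chi1 scale1r. Qed.
Lemma evl_coproduct a : evl chi (coproduct a) = tw chi a.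
Proof.
apply: (linear_ext (f1 := evl chi \o @coproduct k gT) (f2 := tw chi)) => g.
by rewrite /= coproduct_basis /evl glift_basis tw_basis.
Qed.

Lemma evr_coproduct a : evr chi (coproduct a) = tw chi a.
Proof.
apply: (linear_ext (f1 := evr chi \o @coproduct k gT) (f2 := tw chi)) => g.
by rewrite /= coproduct_basis /evr glift_basis tw_basis.
Qed.

Lemma evl_tensl a : evl chi (tensl a) = (functional chi a)%:A.
Proof.
rewrite {1}[a]galg_sum !linear_sum functionalE scaler_suml.
apply: eq_bigr => g _.
by rewrite !linearZ /= tensl_basis /evl glift_basis scalerA.
Qed.

Lemma evl_tensr a : evl chi (tensr a) = a.
Proof.
apply: (linear_ext (f1 := evl chi \o tensr) (f2 := idfun)) => g.
by rewrite /= tensr_basis /evl glift_basis chi1 scale1r.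
Qed.

Let evE := (coproduct_basis, twL_basis, twR_basis, cpL_basis, cpR_basis,
  tensl_basis, tensr_basis, tw_basis, glift_basis).

(** * The twist equation with one of its three legs contracted *)

Lemma ev1_twL F : ev1 chi (twL F) = tensl (evl chi F).
Proof.
apply: (linear_ext (f1 := ev1 chi \o @twL k gT) (f2 := tensl \o evl chi)) => p.
by rewrite /= /evl /ev1 !evE /= linearZ /= !evE.
Qed.
Lemma ev1_twR F : ev1 chi (twR F) = F.
Proof.
apply: (linear_ext (f1 := ev1 chi \o @twR k gT) (f2 := idfun)) => -[g h].
by rewrite /= /ev1 !evE /= chi1 scale1r.
Qed.
Lemma ev1_cpL F : ev1 chi (cpL F) = twl chi F.
Proof.
apply: (linear_ext (f1 := ev1 chi \o @cpL k gT) (f2 := twl chi)) => -[g h].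
by rewrite /= /twl /ev1 !evE.
Qed.
Lemma ev1_cpR F : ev1 chi (cpR F) = coproduct (evl chi F).
Proof.
apply: (linear_ext (f1 := ev1 chi \o @cpR k gT)
  (f2 := @coproduct k gT \o evl chi)) => -[g h].
by rewrite /= /evl /ev1 !evE /= linearZ /= !evE.
Qed.

Lemma ev2_twL F : ev2 chi (twL F) = tensl (evr chi F).
Proof.
apply: (linear_ext (f1 := ev2 chi \o @twL k gT) (f2 := tensl \o evr chi)) => p.
by rewrite /= /evr /ev2 !evE /= linearZ /= !evE.
Qed.
Lemma ev2_twR F : ev2 chi (twR F) = tensr (evl chi F).
Proof.
apply: (linear_ext (f1 := ev2 chi \o @twR k gT) (f2 := tensr \o evl chi)) => p.
by rewrite /= /evl /ev2 !evE /= linearZ /= !evE.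
Qed.
Lemma ev2_cpL F : ev2 chi (cpL F) = twl chi F.
Proof.
apply: (linear_ext (f1 := ev2 chi \o @cpL k gT) (f2 := twl chi)) => -[g h].
by rewrite /= /twl /ev2 !evE.
Qed.
Lemma ev2_cpR F : ev2 chi (cpR F) = twr chi F.
Proof.
apply: (linear_ext (f1 := ev2 chi \o @cpR k gT) (f2 := twr chi)) => -[g h].
by rewrite /= /twr /ev2 !evE.
Qed.

Lemma ev3_twL F : ev3 chi (twL F) = F.
Proof.
apply: (linear_ext (f1 := ev3 chi \o @twL k gT) (f2 := idfun)) => -[g h].
by rewrite /= /ev3 !evE /= chi1 scale1r.
Qed.
Lemma ev3_twR F : ev3 chi (twR F) = tensr (evr chi F).
Proof.
apply: (linear_ext (f1 := ev3 chi \o @twR k gT) (f2 := tensr \o evr chi)) => p.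
by rewrite /= /evr /ev3 !evE /= linearZ /= !evE.
Qed.
Lemma ev3_cpL F : ev3 chi (cpL F) = coproduct (evr chi F).
Proof.
apply: (linear_ext (f1 := ev3 chi \o @cpL k gT)
  (f2 := @coproduct k gT \o evr chi)) => -[g h].
by rewrite /= /evr /ev3 !evE /= linearZ /= !evE.
Qed.
Lemma ev3_cpR F : ev3 chi (cpR F) = twr chi F.
Proof.
apply: (linear_ext (f1 := ev3 chi \o @cpR k gT) (f2 := twr chi)) => -[g h].
by rewrite /= /twr /ev3 !evE.
Qed.

Lemma twist_ev1 F : is_twist F ->
  tensl (evl chi F) * twl chi F = F * coproduct (evl chi F).
Proof.
move=> /is_twistP[_ /(congr1 (ev1 chi))].
by rewrite !ev1M ev1_twL ev1_cpL ev1_twR ev1_cpR.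
Qed.

Lemma twist_ev2 F : is_twist F ->
  tensl (evr chi F) * twl chi F = tensr (evl chi F) * twr chi F.
Proof.
move=> /is_twistP[_ /(congr1 (ev2 chi))].
by rewrite !ev2M ev2_twL ev2_cpL ev2_twR ev2_cpR.
Qed.

Lemma twist_ev3 F : is_twist F ->
  F * coproduct (evr chi F) = tensr (evr chi F) * twr chi F.
Proof.
move=> /is_twistP[_ /(congr1 (ev3 chi))].
by rewrite !ev3M ev3_twL ev3_cpL ev3_twR ev3_cpR.
Qed.

Lemma chi_neq0 g : chi g != 0.
Proof.
apply/eqP => g0; have := chiM g g^-1%g.
by rewrite mulgV chi1 g0 mul0r => /eqP; rewrite oner_eq0.
Qed.

Lemma evl_unit F : F \is a GRing.unit -> evl chi F \is a GRing.unit.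
Proof.
move=> uF; apply/unitrP; exists (evl chi F^-1).
by rewrite -!evlM mulVr // mulrV // evl1.
Qed.

(** Contracting the invariance of [F] shows that [evl chi F] commutes with the image of [tw chi],
    which is everything because twisting by the inverse character undoes it. *)
Lemma evl_central F : is_invariant F -> is_central (evl chi F).
Proof.
move=> iF b; pose psi g := (chi g)^-1.
have tK : tw chi (tw psi b) = b.
  by apply/galgP => g; rewrite !gcoef_tw mulrA divff ?chi_neq0 // mul1r.
by have := congr1 (evl chi) (iF (tw psi b)); rewrite !evlM evl_coproduct tK.
Qed.

Lemma evr_central F : is_invariant F -> is_central (evr chi F).
Proof.
move=> iF b; pose psi g := (chi g)^-1.
have tK : tw chi (tw psi b) = b.
  by apply/galgP => g; rewrite !gcoef_tw mulrA divff ?chi_neq0 // mul1r.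
by have := congr1 (evr chi) (iF (tw psi b)); rewrite !evrM evr_coproduct tK.
Qed.

Lemma evl_delta1 a :
  evl chi (delta1_fun a) = functional chi a *: a * tw chi a^-1.
Proof.
rewrite /delta1_fun evlM evl_coproduct tensorE evlM evl_tensl evl_tensr.
by rewrite -scalerAl mul1r.
Qed.

End Character.

Lemma evl_twl (chi psi : gT -> k) F :
  evl psi (twl chi F) = evl (fun g => psi g * chi g) F.
Proof.
apply: (linear_ext (f1 := evl psi \o twl chi)
  (f2 := evl (fun g => psi g * chi g))) => -[g h].
by rewrite /= /twl tw_basis linearZ /= /evl !glift_basis /= scalerA mulrC.
Qed.

(** The first leg of the twist equation is contracted with [chi], the second with [psi]. Up to
    scalars, [chi |-> evl chi F] is thus a 1-cocycle for the action [tw] of the character group,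
    which is the input of the Hilbert 90 argument. *)
Lemma twist_ev11 (chi psi : gT -> k) F :
    (forall g h, chi (g * h)%g = chi g * chi h) -> chi 1%g = 1 ->
    (forall g h, psi (g * h)%g = psi g * psi h) -> psi 1%g = 1 ->
    is_twist F ->
  functional psi (evl chi F) *: evl (fun g => psi g * chi g) F =
    evl psi F * tw psi (evl chi F).
Proof.
move=> chiM chi1 psiM psi1 /(twist_ev1 chiM chi1)/(congr1 (evl psi)).
by rewrite !evlM // evl_tensl evl_twl evl_coproduct -scalerAl mul1r.
Qed.

(** The coproduct lives on the diagonal, so products of distinct coefficients of [w] vanish and each
    coefficient is its own square. A nonzero coefficient is therefore 1 and the only one. *)
Lemma grouplike w : coproduct w = tensor w w -> w != 0 ->
  exists g, w = gbasis k g.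
Proof.
have cpE g h : gcoef (coproduct w) (g, h) = (g == h)%:R * gcoef w g.
  rewrite [w in LHS]galg_sum linear_sum gcoef_sum (bigD1 g) //= big1 => [|l lg].
    rewrite linearZ gcoefZ /= coproduct_basis gcoef_basis addr0 mulrC.
    by rewrite xpair_eqE eqxx eq_sym.
  rewrite linearZ gcoefZ /= coproduct_basis gcoef_basis xpair_eqE.
  by rewrite eq_sym (negPf lg) mulr0.
move=> wE w0; have wM g h : (g == h)%:R * gcoef w g = gcoef w g * gcoef w h.
  by rewrite -cpE wE gcoef_tensor.
have [g g0] : exists g, gcoef w g != 0.
  apply/existsP; rewrite -negb_forall; apply: contra w0 => /forallP w0.
  by apply/eqP/galgP => g; rewrite (eqP (w0 g)) gcoef0.
exists g; apply/galgP => h; apply: (mulfI g0); rewrite -wM gcoef_basis.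
by rewrite eq_sym mulrC.
Qed.

Lemma central_basis g : is_central (gbasis k g) -> forall h, (g * h = h * g)%g.
Proof.
move=> cg h; have := cg (gbasis k h); rewrite -!gbasisM => /galgP/(_ (g * h)%g).
rewrite !gcoef_basis eqxx; case: eqP => [//|_] /eqP.
by rewrite oner_eq0.
Qed.

(** The flip of the two tensor factors is an algebra map that fixes [tensor a a] and, by
    cocommutativity, every coproduct. *)
Lemma delta1_symmetric a g h :
  gcoef (delta1_fun a) (g, h) = gcoef (delta1_fun a) (h, g).
Proof.
have swM : {morph glift (fun p : gT * gT => gbasis k (p.2, p.1)) :
    F F' / F * F'} by apply: gliftM => p q; rewrite -gbasisM.
set sw := glift _ in swM.
have swE F x y : gcoef (sw F) (x, y) = gcoef F (y, x).
  rewrite /sw /glift gcoef_sum (bigD1 (y, x)) //= big1 ?addr0 => [|[z t] zt].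
    by rewrite gcoefZ gcoef_basis eqxx mulr1.
  rewrite gcoefZ gcoef_basis /= xpair_eqE andbC -xpair_eqE eq_sym (negPf zt).
  by rewrite mulr0.
suff sE : sw (delta1_fun a) = delta1_fun a by rewrite -swE sE.
rewrite /delta1_fun swM; congr (_ * _).
  by apply/galgP => -[x y]; rewrite swE !gcoef_tensor mulrC.
apply: (linear_ext (f1 := sw \o @coproduct k gT) (f2 := @coproduct k gT)) => x.
by rewrite /= coproduct_basis /sw glift_basis.
Qed.

End PartialEvaluation.

(** * The structure of A4 *)

Definition klein := (bool * bool)%type.
Definition kadd (a b : klein) : klein := (a.1 (+) b.1, a.2 (+) b.2).
(** An automorphism of order three, permuting the nonzero elements cyclically; it satisfies
    [1 + rho + rho^2 = 0]. *)
Definition rho (a : klein) : klein := (a.2, a.1 (+) a.2).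
Definition k0 : klein := (false, false).
Definition k1 : klein := (true, false).

Section A4Structure.
Local Open Scope group_scope.
Variables (gT : finGroupType) (v : klein -> gT) (c : gT).
Hypothesis vD : forall a b, v (kadd a b) = v a * v b.
Hypothesis v_inj : injective v.
Hypothesis c3 : c ^+ 3 = 1.
Hypothesis cv : forall a, c * v a = v (rho a) * c.
Hypothesis card12 : #|gT| = 12.

Lemma v0 : v k0 = 1.
Proof. by apply: (mulgI (v k0)); rewrite -vD mulg1. Qed.

Lemma vV a : (v a)^-1 = v a.
Proof.
apply: (mulgI (v a)); rewrite mulgV -vD -v0.
by case: a => [[] []].
Qed.

Lemma vC a b : v a * v b = v b * v a.
Proof. by rewrite -!vD; congr v; case: a b => [[] []] [[] []]. Qed.

Lemma cXv m a : c ^+ m * v a = v (iter m rho a) * c ^+ m.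
Proof.
elim: m => [|m IH]; first by rewrite !expg0 mul1g mulg1.
by rewrite !expgS -mulgA IH mulgA cv mulgA.
Qed.

Definition phi (p : klein * 'I_3) : gT := v p.1 * c ^+ p.2.

Lemma phiJ p x : phi p * v x * (phi p)^-1 = v (iter p.2 rho x).
Proof.
rewrite /phi -(mulgA (v _)) cXv mulgA vC -mulgA invMg -!mulgA.
by rewrite (mulgA (v p.1) (c ^+ _)) -invMg mulgV mulg1.
Qed.

Lemma iter_rho_inj (m n : 'I_3) :
  (forall x, iter m rho x = iter n rho x) -> m = n.
Proof.
move=> /(_ k1) e; apply: val_inj; case: m n e => [[|[|[|]]] //= ?].
all: by case=> [[|[|[|]]] //= ?].
Qed.

(** Conjugation by [phi p] acts on V as the power [p.2] of [rho], which determines [p.2]; the power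
    of [c] then cancels. With the order 12 this gives every element a unique normal form. *)
Lemma phi_inj : injective phi.
Proof.
move=> p q pq; have mn : p.2 = q.2.
  by apply: iter_rho_inj => x; apply: v_inj; rewrite -!phiJ pq.
case: p q pq mn => a m [b n] pq /= mn; move: pq; rewrite -mn /phi /=.
by move/mulIg/v_inj->.
Qed.

Lemma phi_surj g : exists p, g = phi p.
Proof.
have : g \in codom phi.
  rewrite (inj_card_onto phi_inj) // card12 card_prod card_prod card_bool.
  by rewrite card_ord.
by case/codomP => p ->; exists p.
Qed.

Lemma phi_ind (P : gT -> Prop) :
  (forall a (m : 'I_3), P (v a * c ^+ m)) -> forall g, P g.
Proof. by move=> Pvc g; case: (phi_surj g) => -[a m] ->; apply: Pvc. Qed.

(** A central element conjugates V trivially, so it has no power of [c] in its normal form. What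
    remains is some [v a] commuting with [c], so [rho] fixes [a], and only [k0] is fixed. *)
Lemma center_trivial (g : gT) : (forall h, g * h = h * g) -> g = 1.
Proof.
case: (phi_surj g) => -[a m] -> cg.
have m0 : m = ord0.
  by apply: iter_rho_inj => x; apply: v_inj; rewrite -(phiJ (a, m)) cg mulgK.
move: cg; rewrite m0 /phi /= expg0 mulg1 => /(_ c); rewrite cv => /mulIg/v_inj.
by case: a => [[] []] // _; apply: v0.
Qed.

Lemma omega_exists (k : fieldType) (zeta : k) : (zeta ^+ 3 = 1)%R ->
  exists omega : gT -> k,
    (forall g h, omega (g * h) = (omega g * omega h)%R) /\
    (forall a m, omega (v a * c ^+ m) = (zeta ^+ m)%R).
Proof.
(* The sum has a single term, the normal form of [g], and serves to read off its exponent. *)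
move=> z3; pose omega g := (\sum_(p | phi p == g) zeta ^+ p.2)%R.
have omegaE a m : omega (v a * c ^+ m) = (zeta ^+ m)%R.
  (* The exponent [m] is arbitrary here and has to be reduced modulo 3 to reach a normal form. *)
  have m3 : (m %% 3 < 3)%N by rewrite ltn_mod.
  have -> : v a * c ^+ m = phi (a, Ordinal m3) by rewrite /phi /= expg_mod.
  rewrite /omega (eq_bigl (pred1 (a, Ordinal m3))) => [|p]; last first.
    by rewrite /= (inj_eq phi_inj).
  rewrite big_pred1_eq /= {2}(divn_eq m 3) exprD mulnC exprM z3 expr1n.
  by rewrite mul1r.
exists omega; split=> // g h.
case: (phi_surj g) (phi_surj h) => -[a m] -> [[b n] ->].
rewrite /phi /= !mulgA -(mulgA _ _ (v b)) cXv mulgA -vD -mulgA -expgD.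
by rewrite !omegaE exprD.
Qed.

End A4Structure.

(** * Invariant cocycles on the Klein group *)

Section KleinPairing.
Local Open Scope ring_scope.
Variable k : fieldType.

(* Under an identification of [klein] with the field of four elements in which
   [rho] is multiplication by a primitive cube root of unity, [klein_pair x a]
   is [(-1) ^ Tr (x^2 * a)], hence is invariant under [rho]. *)
Definition klein_pair (x a : klein) : k :=
  if [|| x == k0, a == k0 | x == a] then 1 else -1.

(* The bicharacter [(-1) ^ Tr (j * x * y^2)] of the field of four elements, for
   a primitive cube root of unity [j]. *)
Definition klein_cocycle (x y : klein) : k :=
  if [|| x == k0, y == k0 | y == rho (rho x)] then 1 else -1.

Lemma klein_sum (F : klein -> k) :
  \sum_a F a = F (true, true) + F (true, false) + F (false, true) + F k0.
Proof.
transitivity (\sum_a \sum_b F (a, b)).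
  by rewrite pair_bigA; apply: eq_bigr => -[].
by rewrite !big_bool /= addrA.
Qed.

Lemma klein_pairC x a : klein_pair x a = klein_pair a x.
Proof. by rewrite /klein_pair orbCA (eq_sym x a). Qed.

Lemma klein_pairDr x a b :
  klein_pair x (kadd a b) = klein_pair x a * klein_pair x b.
Proof.
by case: x a b => [[] []] [[] []] [[] []]; rewrite /klein_pair /=; ring.
Qed.

Lemma klein_pairDl x y a :
  klein_pair (kadd x y) a = klein_pair x a * klein_pair y a.
Proof. by rewrite !(klein_pairC _ a) klein_pairDr. Qed.

Lemma klein_pair_rho x a : klein_pair (rho x) (rho a) = klein_pair x a.
Proof. by case: x a => [[] []] [[] []]. Qed.

Lemma klein_pair0 x : klein_pair x k0 = 1.
Proof. by rewrite /klein_pair eqxx orbT. Qed.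

Lemma klein_pair_sum x y :
  \sum_a klein_pair x a * klein_pair y a = 4%:R * (x == y)%:R.
Proof.
rewrite klein_sum.
by case: x y => [[] []] [[] []]; rewrite /klein_pair /=; ring.
Qed.

Lemma klein_cocycle_rho x y :
  klein_cocycle (rho x) (rho y) = klein_cocycle x y.
Proof. by case: x y => [[] []] [[] []]. Qed.

Lemma klein_cocycleP x y z :
  klein_cocycle x y * klein_cocycle (kadd x y) z =
  klein_cocycle y z * klein_cocycle x (kadd y z).
Proof.
by case: x y z => [[] []] [[] []] [[] []]; rewrite /klein_cocycle /=; ring.
Qed.

Lemma klein_cocycle_sqr x y : klein_cocycle x y * klein_cocycle x y = 1.
Proof. by rewrite /klein_cocycle; case: ifP => _; ring. Qed.

(** The nine pairs of nonzero elements form three orbits under [rho]. The cocycle identity expresses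
    the diagonal value as [p * s] in terms of the other two and forces [p ^+ 2 = s ^+ 2], so only
    the sign in [p = s] or [p = - s] survives normalization. *)
Lemma klein_cocycle_classification (f : klein -> klein -> k) :
    (forall x y, f x y != 0) -> (forall y, f k0 y = 1) ->
    (forall x y, f (rho x) (rho y) = f x y) ->
    (forall x y z, f x y * f (kadd x y) z = f y z * f x (kadd y z)) ->
  exists2 t, t != 0 &
    let mu x := if x == k0 then 1 else t in
    (forall x y, f x y * (mu x * mu y * (mu (kadd x y))^-1) = 1) \/
    (forall x y,
       f x y * (mu x * mu y * (mu (kadd x y))^-1) = klein_cocycle x y).
Proof.
move=> f0 fl frho fM.
have fr x : f x k0 = 1.
  have := fM x k0 k0; rewrite !fl mul1r.
  have -> : kadd x k0 = x by case: x => [[] []].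
  by move=> e; apply: (mulIf (f0 x k0)); rewrite mul1r.
pose p := f (true, false) (false, true).
pose s := f (false, true) (true, false).
have p2 : f (false, true) (true, true) = p.
  exact: (frho (true, false) (false, true)).
have p3 : f (true, true) (true, false) = p.
  by rewrite -p2; exact: (frho (false, true) (true, true)).
have s2 : f (true, true) (false, true) = s.
  exact: (frho (false, true) (true, false)).
have s3 : f (true, false) (true, true) = s.
  by rewrite -s2; exact: (frho (true, true) (false, true)).
have c1 : f (true, false) (true, false) = p * s.
  by have := fM (true, false) (true, false) (false, true); rewrite fl mulr1 s3.
have c2 : f (false, true) (false, true) = p * s.
  by rewrite -c1; exact: (frho (true, false) (true, false)).
have c4 : f (true, true) (true, true) = p * s.
  by rewrite -c2; exact: (frho (false, true) (false, true)).
have ps : p ^+ 2 = s ^+ 2.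
  by have := fM (true, false) (false, true) (true, false); rewrite p3 s3.
have s0 : s != 0 by apply: f0.
(* The coboundary of [mu] scales the values at distinct nonzero elements by [t] and the diagonal
   ones by [t ^+ 2]; this [t] makes [s] equal to 1 and [p] equal to 1 or -1. *)
exists s^-1; first by rewrite invr_eq0.
move/eqP: ps; rewrite eqf_sqr => /orP[/eqP ps|/eqP ps]; [left|right].
all: by case=> [[] []] [[] []]; rewrite /kadd /= ?fl ?fr ?c1 ?c2 ?c4 ?p2 ?p3
  ?s2 ?s3 -?/p -?/s ?ps /klein_cocycle /=; field; rewrite ?s0 ?oner_neq0.
Qed.

End KleinPairing.

(** * Invariant twists *)

Section A4Twists.
Local Open Scope ring_scope.
Variables (k : fieldType) (gT : finGroupType) (v : klein -> gT) (c : gT).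
Hypothesis vD : forall a b, v (kadd a b) = (v a * v b)%g.
Hypothesis v_inj : injective v.
Hypothesis cv : forall a, (c * v a = v (rho a) * c)%g.
Hypothesis card12 : #|gT| = 12%N.
Variables (zeta : k) (omega : gT -> k).
Hypothesis zetaE : zeta ^+ 2 + zeta + 1 = 0.
Hypothesis two_neq0 : 2%:R != 0 :> k.
Hypothesis three_neq0 : 3%:R != 0 :> k.
Hypothesis omegaM : forall g h, omega (g * h)%g = omega g * omega h.
Hypothesis omegaE : forall a m, omega (v a * c ^+ m)%g = zeta ^+ m.

Let phi_ind := phi_ind vD v_inj cv card12.

Lemma zeta3 : zeta ^+ 3 = 1.
Proof.
apply/eqP; rewrite -subr_eq0; apply/eqP.
transitivity ((zeta - 1) * (zeta ^+ 2 + zeta + 1)); first by ring.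
by rewrite zetaE mulr0.
Qed.

Lemma zeta_neq1 : zeta != 1.
Proof.
apply/eqP => z1; move/eqP: three_neq0; apply.
by rewrite -zetaE z1; ring.
Qed.

Lemma zeta2_neq1 : zeta ^+ 2 != 1.
Proof.
apply: contra zeta_neq1 => /eqP z2; have := zeta3.
by rewrite exprS z2 mulr1 => ->.
Qed.

Lemma order_neq0 : #|gT|%:R != 0 :> k.
Proof. by rewrite card12 -[12%N]/(2 * 2 * 3)%N !natrM !mulf_neq0. Qed.

Lemma omega_v a : omega (v a) = 1.
Proof. by have := omegaE a 0; rewrite mulg1. Qed.

Lemma omega_c : omega c = zeta.
Proof. by have := omegaE k0 1; rewrite (v0 vD) mul1g. Qed.

Lemma omega1 : omega 1%g = 1.
Proof. by rewrite -(v0 vD) omega_v. Qed.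

Lemma omega_cube g : omega g ^+ 3 = 1.
Proof.
elim/phi_ind: g => a m; rewrite omegaE -exprM mulnC exprM zeta3.
by rewrite expr1n.
Qed.

Lemma omega_eq1 g : omega g = 1 -> exists a, g = v a.
Proof.
have [[a m] ->] := phi_surj vD v_inj cv card12 g; rewrite /phi /= omegaE.
case: m => -[|[|[|]]] //= _ => [_|/eqP|/eqP].
- by exists a; rewrite mulg1.
- by rewrite (negPf zeta_neq1).
- by rewrite (negPf zeta2_neq1).
Qed.

(** * The linear characters and the centre of the group algebra *)

Definition chi j g := omega g ^+ j.

Lemma chiM j g h : chi j (g * h)%g = chi j g * chi j h.
Proof. by rewrite /chi omegaM exprMn. Qed.

Lemma chi1 j : chi j 1%g = 1.
Proof. by rewrite /chi omega1 expr1n. Qed.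

Notation ch j := (functional (chi j)).
Definition eps j := char_idem (chi j).

Lemma ch_eps i j : (i < 3)%N -> (j < 3)%N -> ch i (eps j) = (i == j)%:R.
Proof.
have [<-|ij] := eqVneq i j => i3 j3.
  exact: (functional_idem (chiM i) (chi1 i) order_neq0).
apply: (functional_idem0 (chiM j) (g := c)) => [h|]; first exact: chiM.
rewrite /chi omega_c; move: zeta_neq1 zeta2_neq1 => z1 z2.
have z0 : zeta != 0.
  by apply/eqP => z0; move/eqP: zeta3; rewrite z0 expr0n eq_sym oner_eq0.
case: i j ij i3 j3 => [|[|[|]]] // [|[|[|]]] // _ _ _; rewrite ?expr0 ?expr1 //.
- by rewrite eq_sym.
- by rewrite eq_sym.
- apply: contra z1 => /eqP z; apply/eqP/(mulfI z0).
  by rewrite mulr1 -expr2 -z.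
- apply: contra z1 => /eqP z; apply/eqP/(mulfI z0).
  by rewrite mulr1 -expr2 z.
Qed.

(** On central elements this is the scalar of the three-dimensional irreducible representation,
    whose character is 3 at the identity, -1 on the rest of V and 0 elsewhere. *)
Definition lam (a : galg k gT) := gcoef a 1%g - gcoef a (v k1).

(* [cent w x0 x1 x2] acts as the scalar [w] on the three-dimensional
   irreducible representation and as [x_j] on the character [omega ^+ j]. *)
Definition cent (w x0 x1 x2 : k) : galg k gT :=
  w%:A + (x0 - w) *: eps 0 + (x1 - w) *: eps 1 + (x2 - w) *: eps 2.

Lemma lam_cent w x0 x1 x2 : lam (cent w x0 x1 x2) = w.
Proof.
rewrite /lam /cent !gcoefD !gcoefZ -gbasis1 !gcoef_basis eqxx -(v0 vD).
rewrite (inj_eq v_inj) /= /eps !gcoef_idem /chi !(vV vD) !omega_v.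
by rewrite !expr1n; ring.
Qed.

Lemma ch_cent w x0 x1 x2 :
  [/\ ch 0 (cent w x0 x1 x2) = x0, ch 1 (cent w x0 x1 x2) = x1 &
      ch 2 (cent w x0 x1 x2) = x2].
Proof.
split; rewrite /cent !functionalD !functionalZ !ch_eps //.
all: rewrite char_functional1 ?chi1 //.
all: by rewrite /=; ring.
Qed.

Lemma cent_central w x0 x1 x2 : is_central (cent w x0 x1 x2).
Proof.
have ce j : is_central (eps j).
  by apply: idem_central; [exact: chiM|exact: chi1].
move=> b; rewrite /cent !mulrDl !mulrDr -!scalerAl -!scalerAr !ce mulr1 mul1r.
by [].
Qed.

(** A central element killed by [lam] is constant on the cosets of V. On V itself, conjugation by
    [c] is transitive on the nonidentity elements and [lam u = 0] brings in the identity. *)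
Lemma cent_coset (u : galg k gT) a m :
  is_central u -> lam u = 0 -> (m < 3)%N ->
  gcoef u (v a * c ^+ m)%g = gcoef u (c ^+ m)%g.
Proof.
move=> /is_centralP uJ /eqP; rewrite subr_eq0 => /eqP u0.
have urho b : gcoef u (v (rho b)) = gcoef u (v b).
  by rewrite -(uJ c (v b)) cv mulgK.
have uv b : gcoef u (v b) = gcoef u 1%g.
  case: b => -[] []; last by rewrite -(v0 vD).
  - by rewrite u0 -[RHS]urho -[RHS]urho.
  - by rewrite u0.
  - by rewrite u0 -[RHS]urho.
(* Off V, conjugating [c ^+ m] by [v b] multiplies it by [v (b + rho^m b)]. Every [a] has the form
   [b + rho^m b], with [b = rho a] for [m = 1] and [b = rho (rho a)] for [m = 2]. *)
have uc b : gcoef u (v (kadd b (iter m rho b)) * c ^+ m)%g = gcoef u (c ^+ m)%g.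
  rewrite vD -mulgA -(cXv cv) mulgA -(uJ (v b) (c ^+ m)%g).
  by rewrite (vV vD).
case: m uc => [|[|[|]]] // uc _; first by rewrite !expg0 mulg1 uv.
- by rewrite -(uc (rho a)); congr (gcoef u (v _ * _)%g); case: a => [[] []].
- rewrite -(uc (rho (rho a))); congr (gcoef u (v _ * _)%g).
  by case: a => [[] []].
Qed.

Lemma ch_phi j u :
  ch j u = \sum_a \sum_(m < 3) gcoef u (v a * c ^+ m)%g * zeta ^+ (j * m).
Proof.
rewrite functionalE (reindex (phi v c)) /=; last first.
  apply/onW_bij/(inj_card_bij (phi_inj vD v_inj cv)).
  by rewrite card12 card_prod card_prod card_bool card_ord.
rewrite pair_bigA; apply: eq_bigr => -[a m] _ /=.
by rewrite /chi /phi /= omegaE -exprM mulnC.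
Qed.

(** The difference is constant on the three cosets of V, and its three values have zero discrete
    Fourier transform. *)
Lemma cent_ext (u u' : galg k gT) : is_central u -> is_central u' ->
  lam u = lam u' -> (forall j, (j < 3)%N -> ch j u = ch j u') -> u = u'.
Proof.
move=> cu cu' luu' chuu'; apply/eqP; rewrite -subr_eq0; apply/eqP.
set d := u - u'; have cd : is_central d.
  by move=> b; rewrite /d mulrBl mulrBr cu cu'.
have gN w : gcoef (- w) =1 fun g => - gcoef w g :> k.
  by move=> g; rewrite -scaleN1r gcoefZ mulN1r.
have ld : lam d = 0.
  by rewrite /lam /d !gcoefD !gN opprD addrACA -opprD -/(lam _) luu' subrr.
have dE a m : (m < 3)%N -> gcoef d (v a * c ^+ m)%g = gcoef d (c ^+ m)%g.
  exact: cent_coset.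
have chd j : (j < 3)%N -> \sum_(m < 3) gcoef d (c ^+ m)%g * zeta ^+ (j * m) = 0.
  move=> j3; have : ch j d = 0.
    by rewrite /d -scaleN1r functionalD functionalZ chuu' // mulN1r subrr.
  rewrite ch_phi; under eq_bigr do under eq_bigr do rewrite dE //.
  rewrite sumr_const card_prod card_bool -mulr_natr => /eqP.
  by rewrite mulf_eq0 (natrM _ 2 2) mulf_eq0 !(negPf two_neq0) !orbF => /eqP.
have := chd 0%N isT; have := chd 1%N isT; have := chd 2%N isT.
rewrite !big_ord_recl !big_ord0 /= /bump /= !muln0 !expr0 !mulr1 !addr0.
rewrite !addn0 !muln1 !mul1n -[(1 + 1)%N]/2%N -[(2 * 2)%N]/4%N !expr1.
rewrite expg0 expg1.
set d0 := gcoef d 1%g; set d1 := gcoef d c; set d2 := gcoef d _ => e2 e1 e0.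
(* The transform of order three is inverted by adding the equations with powers of [zeta] as
   weights; what is left over is a multiple of [zeta ^+ 2 + zeta + 1]. *)
have d00 : d0 = 0.
  apply: (mulfI three_neq0); rewrite mulr0.
  transitivity ((d0 + (d1 + d2)) + (d0 + (d1 * zeta + d2 * zeta ^+ 2)) +
    (d0 + (d1 * zeta ^+ 2 + d2 * zeta ^+ 4)) -
    (zeta ^+ 2 + zeta + 1) * (d1 + d2 * (zeta ^+ 2 - zeta + 1))); first by ring.
  by rewrite e0 e1 e2 zetaE; ring.
have d10 : d1 = 0.
  apply: (mulfI three_neq0); rewrite mulr0.
  transitivity ((d0 + (d1 + d2)) +
    zeta ^+ 2 * (d0 + (d1 * zeta + d2 * zeta ^+ 2)) +
    zeta * (d0 + (d1 * zeta ^+ 2 + d2 * zeta ^+ 4)) -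
    (zeta ^+ 2 + zeta + 1) *
      (d0 + d1 * (2 * zeta - 2) + d2 * (zeta ^+ 3 - zeta + 1))).
    by ring.
  by rewrite e0 e1 e2 zetaE; ring.
have d20 : d2 = 0 by move: e0; rewrite d00 d10 !add0r.
apply/galgP => g; elim/phi_ind: g => a m; rewrite dE //.
rewrite gcoef0; case: m => -[|[|[|n]]] lt_n3 /=; rewrite ?expg0 ?expg1 //.
Qed.

(** The centre thus has the four coordinates [lam], [ch 0], [ch 1], [ch 2], and by [centM]
    multiplication is coordinatewise. *)
Lemma centE u : is_central u -> u = cent (lam u) (ch 0 u) (ch 1 u) (ch 2 u).
Proof.
move=> cu; apply: cent_ext => //; first exact: cent_central.
  by rewrite lam_cent.
have [e0 e1 e2] := ch_cent (lam u) (ch 0 u) (ch 1 u) (ch 2 u).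
by case=> [|[|[|]]].
Qed.

Lemma centM w x0 x1 x2 w' y0 y1 y2 :
  cent w x0 x1 x2 * cent w' y0 y1 y2 =
    cent (w * w') (x0 * y0) (x1 * y1) (x2 * y2).
Proof.
rewrite {2}/cent !mulrDr -!scalerAr mulr1 !mul_idem; try exact: chiM.
have [-> -> ->] := ch_cent w x0 x1 x2.
by apply/galgP => g; rewrite /cent !(gcoefD, gcoefZ); ring.
Qed.

Lemma cent1 : cent 1 1 1 1 = 1.
Proof. by rewrite /cent subrr !scale0r !addr0 scale1r. Qed.

Lemma centV w x0 x1 x2 : w != 0 -> x0 != 0 -> x1 != 0 -> x2 != 0 ->
  cent w x0 x1 x2 \is a GRing.unit /\
  (cent w x0 x1 x2)^-1 = cent w^-1 x0^-1 x1^-1 x2^-1.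
Proof.
move=> w0 x00 x10 x20; set a := cent _ _ _ _; set b := cent _^-1 _ _ _.
have ab : a * b = 1 by rewrite centM !mulfV // cent1.
have ba : b * a = 1 by rewrite centM !mulVf // cent1.
have ua : a \is a GRing.unit by apply/unitrP; exists b.
by split=> //; apply: (mulrI ua); rewrite mulrV.
Qed.

Lemma lamM u u' :
  is_central u -> is_central u' -> lam (u * u') = lam u * lam u'.
Proof. by move=> /centE-> /centE->; rewrite centM !lam_cent. Qed.

Lemma lamZ x u : lam (x *: u) = x * lam u.
Proof. by rewrite /lam !gcoefZ mulrBr. Qed.

Lemma lam_tw u : lam (tw omega u) = lam u.
Proof. by rewrite /lam !gcoef_tw omega1 omega_v !mul1r. Qed.

Lemma central_unit u : is_central u -> u \is a GRing.unit ->
  lam u != 0 /\ forall j, ch j u != 0.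
Proof.
move=> cu uu; have cV : is_central u^-1 by move=> b; apply/esym/commrV/esym/cu.
split.
  apply/eqP => l0; have := lamM cu cV.
  rewrite l0 mul0r divrr // -cent1 lam_cent.
  by move/eqP; rewrite oner_eq0.
move=> j; apply/eqP => l0; have := char_functionalM (chiM j) u u^-1.
rewrite l0 mul0r divrr // char_functional1 ?chi1 // => /eqP.
by rewrite oner_eq0.
Qed.

(** Tensoring with [omega] permutes the three linear characters cyclically and fixes the
    three-dimensional representation. *)
Lemma tw_cent w x0 x1 x2 : tw omega (cent w x0 x1 x2) = cent w x1 x2 x0.
Proof.
apply/galgP => g; rewrite gcoef_tw /cent !(gcoefD, gcoefZ) -gbasis1.
rewrite gcoef_basis /eps !gcoef_idem /chi.
(* The values of [omega] are cube roots of unity, so inversion is squaring. *)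
have gV : omega g = omega (g^-1)%g ^+ 2.
  by rewrite -[LHS]mulr1 -(omega_cube (g^-1)%g) exprS mulrA -omegaM mulgV omega1
    mul1r.
have -> : omega g * (w * (g == 1%g)%:R +
   (x0 - w) * (#|gT|%:R^-1 * omega (g^-1)%g ^+ 0) +
   (x1 - w) * (#|gT|%:R^-1 * omega (g^-1)%g ^+ 1) +
   (x2 - w) * (#|gT|%:R^-1 * omega (g^-1)%g ^+ 2)) =
   w * (omega g * (g == 1%g)%:R) +
   (x0 - w) * #|gT|%:R^-1 * omega g + (omega g * omega (g^-1)%g) *
   ((x1 - w) * #|gT|%:R^-1 +
   (x2 - w) * #|gT|%:R^-1 * omega (g^-1)%g) by ring.
have -> : omega g * (g == 1%g)%:R = (g == 1%g)%:R.
  by case: eqP => [->|]; rewrite ?mulr0 // omega1 mulr1.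
by rewrite -omegaM mulgV omega1 gV; ring.
Qed.

(** * Normalization of a twist by Hilbert 90 *)

Lemma chiS i : (fun g => chi 1 g * chi i g) = chi i.+1.
Proof. by apply/funext => g; rewrite /chi -exprD. Qed.

Lemma chi3 : chi 3 = chi 0.
Proof. by apply/funext => g; rewrite /chi omega_cube. Qed.

(** In each of the four coordinates the product of central elements equals [l]; in the last one this
    uses the norm relation [s * x1 * x2 = l ^+ 3]. *)
Lemma cent_normalizer s l x1 x2 :
    s != 0 -> l != 0 -> x1 != 0 -> s * x1 * x2 = l ^+ 3 ->
  l^-1 *: (cent l s x1 x2 * (cent 1 s^-1 l^-1 (x1 / (l * l)) *
    cent 1^-1 l^-1^-1 (x1 / (l * l))^-1 s^-1^-1)) = 1.
Proof.
move=> s0 l0 x10 e.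
have -> : x2 = l ^+ 3 / (s * x1) by rewrite -e; field; rewrite s0 x10.
rewrite !centM [X in cent X _ _ _](_ : _ = l); last by rewrite divr1 mulr1.
rewrite [X in cent _ X _ _](_ : _ = l); last first.
  by field; rewrite ?s0 ?l0 ?x10 ?oner_neq0.
rewrite [X in cent _ _ X _](_ : _ = l); last first.
  by field; rewrite ?s0 ?l0 ?x10 ?oner_neq0.
rewrite [X in cent _ _ _ X](_ : _ = l); last first.
  by field; rewrite ?s0 ?l0 ?x10 ?oner_neq0.
by rewrite /cent subrr !scale0r !addr0 scalerA mulVf // scale1r.
Qed.

(** The contractions of [F] with the powers of [omega] obey the cocycle identity [twist_ev11]. In
    coordinates [tw omega] is a cyclic shift, so the Hilbert 90 equation can be solved
    explicitly. *)
Lemma twist_normalize F : is_twist F -> is_invariant F ->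
  exists a : A1 k gT,
    evl (chi 0) (F * delta1_fun (A1_val a)) = 1 /\
    evl omega (F * delta1_fun (A1_val a)) = 1.
Proof.
move=> tF iF; have uF : F \is a GRing.unit by case: tF.
have cu j := evl_central (chiM j) (chi1 j) iF.
have uu j := evl_unit (chiM j) (chi1 j) uF.
have twF i j := twist_ev11 (chiM i) (chi1 i) (chiM j) (chi1 j) tF.
pose u := evl (chi 1) F.
have [lu0 x0] := central_unit (cu 1%N) (uu 1%N).
have chT i j w : ch i (tw (chi j) w) = ch (i + j) w.
  rewrite !functionalE; apply: eq_bigr => g _; rewrite gcoef_tw /chi exprD.
  by ring.
have tw0 w : tw (chi 0) w = w.
  by apply/galgP => g; rewrite gcoef_tw /chi expr0 mul1r.
pose s := ch 0 u.
(* The cocycle identity makes [chi 0 (x) id] of [F] the scalar [s]. *)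
have u0E : evl (chi 0) F = s%:A.
  have u00 : evl (chi 0) F = (ch 0 (evl (chi 0) F))%:A.
    have := twF 0%N 0%N; rewrite tw0 (_ : (fun g => _) = chi 0) => [h|].
      by apply: (mulIr (uu 0%N)); rewrite -h -scalerAl mul1r.
    by apply/funext => g; rewrite /chi expr0 mulr1.
  have : s *: u = ch 0 (evl (chi 0) F) *: u.
    have := twF 1%N 0%N; rewrite tw0 (_ : (fun g => _) = chi 1) => [h|].
      by rewrite -[RHS]mulr_algl -u00 -h.
    by apply/funext => g; rewrite /chi expr0 mul1r.
  move/eqP; rewrite -subr_eq0 -scalerBl scaler_eq0 subr_eq0.
  have u_neq0 : u != 0.
    by apply: contraTneq (uu 1%N) => u0; rewrite -/u u0 unitr0.
  by rewrite (negPf u_neq0) orbF => /eqP->; apply: u00.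
set x1 := ch 1 u; set x2 := ch 2 u; set l := lam u.
(* The cocycle identity is used along the cyclic group: from [chi 1] to [chi 2], then from [chi 2]
   to [chi 3 = chi 0]. *)
have eA : x1 *: evl (chi 2) F = u * tw omega u.
  by have := twF 1%N 1%N; rewrite chiS.
have eB : ch 1 (evl (chi 2) F) *: (s%:A : galg k gT) =
    u * tw omega (evl (chi 2) F).
  by have := twF 2%N 1%N; rewrite chiS chi3 u0E.
have ctw w : is_central w -> is_central (tw omega w).
  by move=> /centE->; rewrite tw_cent; apply: cent_central.
have e1 : x1 * lam (evl (chi 2) F) = l * l.
  by rewrite -lamZ eA lamM ?lam_tw //; [exact: cu|apply/ctw/cu].
have e2 : ch 1 (evl (chi 2) F) = x2.
  have := congr1 (ch 1) eA.
  rewrite functionalZ char_functionalM; last exact: chiM.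
  by rewrite -[tw omega u]/(tw (chi 1) u) chT; apply: mulfI; apply: x0.
(* This is the norm condition of Hilbert 90, obtained by eliminating the contraction with
   [chi 2]. *)
have e3 : s * x1 * x2 = l ^+ 3.
  have := congr1 lam eB; rewrite lamM ?lam_tw ?e2 //; [|exact: cu|apply/ctw/cu].
  have lam1 : lam 1 = 1 by rewrite -cent1 lam_cent.
  rewrite !lamZ lam1 mulr1 -/l => e.
  have -> : s * x1 * x2 = x1 * (x2 * s) by ring.
  by rewrite e mulrCA e1; ring.
have l0 : l != 0 by apply: lu0.
have s0 : s != 0 by apply: x0.
have x10 : x1 != 0 by apply: x0.
(* Comparing coordinates in the desired equation gives [l^-1] on [chi 1], then [s^-1] on [chi 0] and
   [x1 / (l * l)] on [chi 2]. The coordinate 1 on the three-dimensional representation is a free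
   choice; [cent t 1 1 1] exploits this freedom later. *)
have [ua aV] := centV (oner_neq0 k) (invr_neq0 s0) (invr_neq0 l0)
  (mulf_neq0 x10 (invr_neq0 (mulf_neq0 l0 l0))).
move: ua aV; set a := cent _ _ _ _ => ua aV.
have ca : is_central a by apply: cent_central.
have Ha : `[< a \is a GRing.unit /\ is_central a >] by apply/asboolP.
exists (MkA1 Ha) => /=; have [a0 a1 _] := ch_cent 1 s^-1 l^-1 (x1 * (l * l)^-1).
split.
  rewrite evlM ?evl_delta1; try exact: chiM; try exact: chi1.
  rewrite u0E tw0 -[in ch 0 a]/a a0 -scalerAl mul1r -scalerAl divrr // scalerA.
  by rewrite divff // scale1r.
rewrite -[omega]/(chi 1) evlM ?evl_delta1; try exact: chiM; try exact: chi1.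
have uE : evl (chi 1) F = cent l s x1 x2 by apply: centE.
rewrite a1 aV {}uE -[tw (chi 1)]/(tw omega) tw_cent -scalerAl -scalerAr.
exact: cent_normalizer.
Qed.

(** * Normalized twists live on the Klein four-subgroup *)

Lemma twist_supported F : is_twist F -> is_invariant F -> evl omega F = 1 ->
  forall g h, gcoef F (g, h) != 0 -> omega g = 1 /\ omega h = 1.
Proof.
move=> tF iF F1; have uF : F \is a GRing.unit by case: tF.
have lF : twl omega F = F.
  have := twist_ev1 omegaM omega1 tF.
  by rewrite F1 (coproduct1) mulr1 /tensl tensor1 mul1r.
pose w := evr omega F; have cw : is_central w := evr_central omegaM omega1 iF.
have rF : twr omega F = tensl w * F.
  have := twist_ev2 omegaM tF.
  by rewrite F1 lF /tensr tensor1 mul1r => <-.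
have wF : coproduct w = tensor w w.
  (* The third leg gives [F * coproduct w = tensor w w * F]; since [tensor w w] is central, the unit
     [F] cancels. *)
  apply: (mulrI uF); rewrite (twist_ev3 omegaM omega1 tF) -/w rF mulrA.
  by rewrite tensr_tensl (tensor_central cw cw).
have w_neq0 : w != 0.
  apply: contraTneq uF => w0.
  suff -> : F = 0 by rewrite unitr0.
  apply/galgP => -[g h]; have := congr1 (fun u => gcoef u (g, h)) rF.
  rewrite /= gcoef_tw w0 linear0 mul0r gcoef0 => /eqP; rewrite mulf_eq0.
  by rewrite (negPf (chi_neq0 omegaM omega1 h)) => /eqP->.
have [g wg] := grouplike wF w_neq0.
have g1 : g = 1%g.
  apply: (center_trivial vD v_inj cv card12); apply: (@central_basis k).
  by rewrite -wg.
have {}rF : twr omega F = F by rewrite rF wg g1 gbasis1 /tensl tensor1 mul1r.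
move=> x y Fxy; split.
  apply: (mulIf Fxy); rewrite mul1r -[in RHS]lF.
  by rewrite gcoef_tw.
apply: (mulIf Fxy); rewrite mul1r -[in RHS]rF.
by rewrite gcoef_tw.
Qed.

(** * Fourier analysis on the Klein four-subgroup and its powers *)

Local Notation kpair := (klein_pair k).

Lemma v_group_set : group_set [set v a | a : klein].
Proof.
apply/group_setP; split; first by apply/imsetP; exists k0; rewrite ?(v0 vD).
move=> _ _ /imsetP[a _ ->] /imsetP[b _ ->]; apply/imsetP.
by exists (kadd a b); rewrite ?vD.
Qed.
Canonical Vgroup := Group v_group_set.
Definition V2group := setX_group Vgroup Vgroup.
Definition V3group := setX_group V2group Vgroup.

Lemma v_in a : v a \in Vgroup.
Proof. by apply/imsetP; exists a. Qed.

(* Extended by 0 outside [V], hence multiplicative only when the first factor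
   lies in [V]. *)
Definition vchar (x : klein) (g : gT) : k := \sum_a kpair x a * (g == v a)%:R.

Lemma vchar_v x a : vchar x (v a) = kpair x a.
Proof.
rewrite /vchar (bigD1 a) //= eqxx mulr1 big1 ?addr0 // => b ba.
by rewrite (inj_eq v_inj) eq_sym (negPf ba) mulr0.
Qed.

Lemma vchar_out x g : g \notin Vgroup -> vchar x g = 0.
Proof.
move=> gV; rewrite /vchar big1 // => a _; case: eqP gV => [->|_ _].
  by rewrite v_in.
by rewrite mulr0.
Qed.

Lemma V_ind (P : gT -> Prop) :
  (forall a, P (v a)) -> (forall g, g \notin Vgroup -> P g) -> forall g, P g.
Proof.
move=> Pv PV g; case: (boolP (g \in Vgroup)) => [/imsetP[a _ ->]|/PV//].
exact: Pv.
Qed.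

Lemma vchar1 x : vchar x 1%g = 1.
Proof. by rewrite -(v0 vD) vchar_v klein_pair0. Qed.

Lemma vcharM x g h : g \in Vgroup -> vchar x (g * h)%g = vchar x g * vchar x h.
Proof.
case/imsetP => a _ ->; elim/V_ind: h => [b|h hV].
  by rewrite -vD !vchar_v klein_pairDr.
by rewrite [vchar x h]vchar_out // mulr0 vchar_out // groupMl // v_in.
Qed.

Lemma vcharD x y g : vchar (kadd x y) g = vchar x g * vchar y g.
Proof.
elim/V_ind: g => [b|g gV]; first by rewrite !vchar_v klein_pairDl.
by rewrite !vchar_out // mulr0.
Qed.

Lemma vchar_sum (a : gT -> k) x :
  \sum_g a g * vchar x g = \sum_b a (v b) * kpair x b.
Proof.
under eq_bigr do rewrite mulr_sumr.
rewrite exchange_big; apply: eq_bigr => b _ /=.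
rewrite (bigD1 (v b)) //= eqxx mulr1 big1 ?addr0 // => g gb.
by rewrite (negPf gb) !mulr0.
Qed.

Lemma vchar_orthogonal x y :
  \sum_g vchar x g * vchar y g = 4%:R * (x == y)%:R.
Proof.
by rewrite vchar_sum; under eq_bigr do rewrite vchar_v; apply: klein_pair_sum.
Qed.

Lemma vchar_orthogonal_dual g h : g \in Vgroup -> h \in Vgroup ->
  \sum_x vchar x g * vchar x h = 4%:R * (g == h)%:R.
Proof.
move=> /imsetP[a _ ->] /imsetP[b _ ->]; under eq_bigr do rewrite !vchar_v.
under eq_bigr => x _ do rewrite !(klein_pairC _ x).
by rewrite klein_pair_sum (inj_eq v_inj).
Qed.

(** Conjugation by [v a] is trivial on V and conjugation by [c] is [rho] there, which the pairing
    respects. Both preserve V, hence also the vanishing of [vchar] outside it. *)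
Lemma vcharJ x g h a m : h = (v a * c ^+ m)%g ->
  vchar (iter m rho x) (h * g * h^-1)%g = vchar x g.
Proof.
move=> ->.
have cJ y l : vchar (rho y) (c * l * c^-1)%g = vchar y l.
  elim/V_ind: l => [b|l lV]; first by rewrite cv mulgK !vchar_v klein_pair_rho.
  rewrite !vchar_out //; apply: contra lV => /imsetP[b _ lb].
  have [d bd] : exists d, b = rho d.
    by exists (rho (rho b)); case: (b) => [[] []].
  move: lb; rewrite bd => lb; apply/imsetP; exists d => //.
  apply: (mulgI c); apply: (mulIg (c^-1)%g).
  by rewrite lb cv mulgK.
have vJ y b l : vchar y (v b * l * (v b)^-1)%g = vchar y l.
  rewrite -mulgA vcharM ?v_in //; elim/V_ind: l => [d|l lV].
    by rewrite vcharM ?v_in // (vV vD) mulrCA -vcharM ?v_in // -vD !vchar_v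
      -klein_pairDr; congr kpair; case: b d => [[] []] [[] []].
  rewrite [RHS]vchar_out // [X in _ * X]vchar_out ?mulr0 //.
  by rewrite groupMr // groupV v_in.
rewrite invMg !mulgA -(mulgA (v a)) -(mulgA (v a)) vJ.
elim: m => [|m IH]; first by rewrite expg0 invg1 mulg1 mul1g.
by rewrite iterS expgS invMg !mulgA -(mulgA c) -(mulgA c) cJ.
Qed.

Definition vchar2 (p : klein * klein) (g : gT * gT) : k :=
  vchar p.1 g.1 * vchar p.2 g.2.
Definition vchar3 (p : klein * klein * klein) (g : gT * gT * gT) : k :=
  vchar2 p.1 g.1 * vchar p.2 g.2.

Lemma vchar2M p g h : g \in V2group ->
  vchar2 p (g * h)%g = vchar2 p g * vchar2 p h.
Proof.
by case: g => g1 g2 /setXP[V1 V2]; rewrite /vchar2 /= !vcharM // mulrACA.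
Qed.

Lemma vchar3M p g h : g \in V3group ->
  vchar3 p (g * h)%g = vchar3 p g * vchar3 p h.
Proof.
case: g => g1 g2 /setXP[V1 V2].
by rewrite /vchar3 /= vcharM // vchar2M // mulrACA.
Qed.

Let mul4_4 : 4%:R * 4%:R = 16%:R :> k.
Proof. by ring. Qed.

Let mul16_4 : 16%:R * 4%:R = 64%:R :> k.
Proof. by ring. Qed.

Let natr_andb (b b' : bool) : b%:R * b'%:R = (b && b')%:R :> k.
Proof. by rewrite -natrM mulnb. Qed.

Lemma vchar2_orthogonal p q :
  \sum_g vchar2 p g * vchar2 q g = 16%:R * (p == q)%:R.
Proof.
transitivity (\sum_g \sum_h (vchar p.1 g * vchar q.1 g) *
  (vchar p.2 h * vchar q.2 h)).
  by rewrite pair_bigA; apply: eq_bigr => g _; rewrite /vchar2 mulrACA.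
rewrite -big_distrlr /= !vchar_orthogonal mulrACA mul4_4 natr_andb.
by case: p q => [p1 p2] [q1 q2]; rewrite xpair_eqE.
Qed.

Lemma vchar2_orthogonal_dual g h : g \in V2group -> h \in V2group ->
  \sum_p vchar2 p g * vchar2 p h = 16%:R * (g == h)%:R.
Proof.
case: g h => [g1 g2] [h1 h2] /setXP[gV1 gV2] /setXP[hV1 hV2].
transitivity (\sum_x \sum_y (vchar x g1 * vchar x h1) *
  (vchar y g2 * vchar y h2)).
  by rewrite pair_bigA; apply: eq_bigr => p _; rewrite /vchar2 /= mulrACA.
by rewrite -big_distrlr /= !vchar_orthogonal_dual // mulrACA mul4_4 natr_andb
  xpair_eqE.
Qed.

Lemma vchar3_orthogonal_dual g h : g \in V3group -> h \in V3group ->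
  \sum_p vchar3 p g * vchar3 p h = 64%:R * (g == h)%:R.
Proof.
case: g h => [g1 g2] [h1 h2] /setXP[gV1 gV2] /setXP[hV1 hV2].
transitivity (\sum_x \sum_y (vchar2 x g1 * vchar2 x h1) *
  (vchar y g2 * vchar y h2)).
  by rewrite pair_bigA; apply: eq_bigr => p _; rewrite /vchar3 /= mulrACA.
rewrite -big_distrlr /= vchar2_orthogonal_dual // vchar_orthogonal_dual //.
by rewrite mulrACA mul16_4 natr_andb
  xpair_eqE.
Qed.

Lemma sixteen_neq0 : 16%:R != 0 :> k.
Proof. by rewrite -[16%N]/(2 ^ 4)%N natrX expf_neq0. Qed.

Lemma sixtyfour_neq0 : 64%:R != 0 :> k.
Proof. by rewrite -[64%N]/(2 ^ 6)%N natrX expf_neq0. Qed.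

Lemma vchar2_inj F F' : supported V2group F -> supported V2group F' ->
  (forall x y, functional (vchar2 (x, y)) F = functional (vchar2 (x, y)) F') ->
  F = F'.
Proof.
move=> sF sF' FF'; apply: functional_inj sixteen_neq0 _ sF sF' _.
  exact: vchar2_orthogonal_dual.
by case.
Qed.

Lemma vchar3_inj F F' : supported V3group F -> supported V3group F' ->
  (forall p, functional (vchar3 p) F = functional (vchar3 p) F') ->
  F = F'.
Proof.
move=> sF sF' FF'; apply: functional_inj sixtyfour_neq0 _ sF sF' _ => //.
exact: vchar3_orthogonal_dual.
Qed.

(** * The twist equation as a 2-cocycle identity for the Fourier transform *)

Lemma vchar3_twL x y z (F : galg k (gT * gT)%type) :
  functional (vchar3 (x, y, z)) (twL F) = functional (vchar2 (x, y)) F.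
Proof.
apply: (linear_ext (V := k^o) (f1 := functional (vchar3 (x, y, z)) \o @twL k gT)
  (f2 := functional (vchar2 (x, y)))) => p.
by rewrite /= twL_basis !functional_basis /vchar3 /= vchar1 mulr1.
Qed.

Lemma vchar3_twR x y z (F : galg k (gT * gT)%type) :
  functional (vchar3 (x, y, z)) (twR F) = functional (vchar2 (y, z)) F.
Proof.
apply: (linear_ext (V := k^o) (f1 := functional (vchar3 (x, y, z)) \o @twR k gT)
  (f2 := functional (vchar2 (y, z)))) => p.
by rewrite /= twR_basis !functional_basis /vchar3 /vchar2 /= vchar1 mul1r.
Qed.

Lemma vchar3_cpL x y z (F : galg k (gT * gT)%type) :
  functional (vchar3 (x, y, z)) (cpL F) = functional (vchar2 (kadd x y, z)) F.
Proof.
apply: (linear_ext (V := k^o) (f1 := functional (vchar3 (x, y, z)) \o @cpL k gT)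
  (f2 := functional (vchar2 (kadd x y, z)))) => p.
by rewrite /= cpL_basis !functional_basis /vchar3 /vchar2 /= vcharD.
Qed.

Lemma vchar3_cpR x y z (F : galg k (gT * gT)%type) :
  functional (vchar3 (x, y, z)) (cpR F) = functional (vchar2 (x, kadd y z)) F.
Proof.
apply: (linear_ext (V := k^o) (f1 := functional (vchar3 (x, y, z)) \o @cpR k gT)
  (f2 := functional (vchar2 (x, kadd y z)))) => p.
by rewrite /= cpR_basis !functional_basis /vchar3 /vchar2 /= vcharD mulrA.
Qed.

Lemma supported_image (hT : finGroupType) (H : {set gT * gT}) (K : {set hT})
    (f : {linear galg k (gT * gT)%type -> galg k hT}) (e : gT * gT -> hT) F :
    (forall p, f (gbasis k p) = gbasis k (e p)) ->
    (forall p, p \in H -> e p \in K) ->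
  supported H F -> supported K (f F).
Proof.
move=> fE HK sF g gK; rewrite [F]galg_sum linear_sum gcoef_sum big1 // => p _.
rewrite linearZ gcoefZ /= fE gcoef_basis.
have [pH|pH] := boolP (p \in H); last by rewrite sF // mul0r.
by case: eqP gK => [->|_]; rewrite ?mulr0 // HK.
Qed.

Lemma supported_twL (F : galg k (gT * gT)%type) :
  supported V2group F -> supported V3group (twL F).
Proof.
apply: supported_image; first exact: twL_basis.
by move=> p pV; apply/setXP; split; rewrite ?group1.
Qed.

Lemma supported_twR (F : galg k (gT * gT)%type) :
  supported V2group F -> supported V3group (twR F).
Proof.
apply: supported_image; first exact: twR_basis.
move=> [p q] /setXP[pV qV]; apply/setXP; split=> //.
by apply/setXP; split=> //; apply: (group1 Vgroup).
Qed.

Lemma supported_cpL (F : galg k (gT * gT)%type) :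
  supported V2group F -> supported V3group (cpL F).
Proof.
apply: supported_image; first exact: cpL_basis.
by move=> [p q] /setXP[pV qV]; apply/setXP; split; [apply/setXP; split|].
Qed.

Lemma supported_cpR (F : galg k (gT * gT)%type) :
  supported V2group F -> supported V3group (cpR F).
Proof.
apply: supported_image; first exact: cpR_basis.
by move=> [p q] /setXP[pV qV]; apply/setXP; split; [apply/setXP; split|].
Qed.

(** Both sides of the twist equation are supported on the cube of V, where the functionals of
    [vchar3] are multiplicative and jointly injective. *)
Lemma twist_vchar2 (F : galg k (gT * gT)%type) : supported V2group F ->
  twL F * cpL F = twR F * cpR F <->
  forall x y z,
    functional (vchar2 (x, y)) F * functional (vchar2 (kadd x y, z)) F =
    functional (vchar2 (y, z)) F * functional (vchar2 (x, kadd y z)) F.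
Proof.
move=> sF; split=> [tF x y z|tF].
  have := congr1 (functional (vchar3 (x, y, z))) tF.
  rewrite (functionalM (H := V3group)); last exact: supported_twL; last first.
    exact: vchar3M.
  rewrite (functionalM (H := V3group)); last exact: supported_twR; last first.
    exact: vchar3M.
  by rewrite vchar3_twL vchar3_cpL vchar3_twR vchar3_cpR.
apply: vchar3_inj => [||[[x y] z]].
- by apply: supportedM; [apply: supported_twL|apply: supported_cpL].
- by apply: supportedM; [apply: supported_twR|apply: supported_cpR].
rewrite (functionalM (H := V3group)); last exact: supported_twL; last first.
  exact: vchar3M.
rewrite (functionalM (H := V3group)); last exact: supported_twR; last first.
  exact: vchar3M.
by rewrite vchar3_twL vchar3_cpL vchar3_twR vchar3_cpR.
Qed.

(** * Invariance on the Fourier side, and the nontrivial twist *)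

Lemma vchar2J x y F g a m : is_invariant F -> g = (v a * c ^+ m)%g ->
  functional (vchar2 (iter m rho x, iter m rho y)) F =
  functional (vchar2 (x, y)) F.
Proof.
move=> /is_invariantP iF gE; rewrite !functionalE.
have bij_conj : bijective (fun p : gT * gT =>
    (g * p.1 * g^-1, g * p.2 * g^-1)%g).
  by exists (fun p => (g^-1 * p.1 * g, g^-1 * p.2 * g)%g) => -[p q] /=;
    rewrite !mulgA ?mulVg ?mulgV !mul1g ?mulgK ?mulgKV.
rewrite (reindex _ (onW_bij _ bij_conj)) /=; apply: eq_bigr => -[p q] _.
by rewrite iF /vchar2 /= !(vcharJ _ _ gE).
Qed.

(** The inverse Fourier transform of [klein_cocycle]; 16 is the order of V x V, and the characters
    of V are their own inverses. *)
Definition A4_twist : galg k (gT * gT)%type :=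
  [ffun g => 16%:R^-1 * \sum_p klein_cocycle k p.1 p.2 * vchar2 p g].

Lemma gcoef_A4_twist g : gcoef A4_twist g =
  16%:R^-1 * \sum_p klein_cocycle k p.1 p.2 * vchar2 p g.
Proof. by rewrite /gcoef ffunE. Qed.

Lemma A4_twist_supported : supported V2group A4_twist.
Proof.
move=> [g h] ghV; rewrite gcoef_A4_twist big1 ?mulr0 // => p _.
rewrite /vchar2 /=.
have [gV|gV] := boolP (g \in Vgroup); last by rewrite vchar_out // mul0r mulr0.
have [hV|hV] := boolP (h \in Vgroup); last by rewrite (vchar_out _ hV) !mulr0.
by case/negP: ghV; apply/setXP.
Qed.

Lemma vchar2_A4_twist x y :
  functional (vchar2 (x, y)) A4_twist = klein_cocycle k x y.
Proof.
rewrite functionalE.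
under eq_bigr do rewrite gcoef_A4_twist -mulrA mulr_suml.
rewrite -mulr_sumr exchange_big /=.
under eq_bigr => p _.
  under eq_bigr do rewrite -mulrA.
  rewrite -mulr_sumr vchar2_orthogonal mulrCA.
  over.
rewrite -mulr_sumr mulKf ?sixteen_neq0 // (bigD1 (x, y)) //= eqxx mulr1.
by rewrite big1 ?addr0 // => p /negPf->; rewrite mulr0.
Qed.

(** Conjugation permutes the characters by a power of [rho]. Reindexing the sum by that power moves
    it onto [klein_cocycle], which is invariant. *)
Lemma A4_twist_invariant : is_invariant A4_twist.
Proof.
apply/is_invariantP => t g h; have [[a m] tE] := phi_surj vD v_inj cv card12 t.
rewrite !gcoef_A4_twist; congr (_ * _).
have rho_bij : bijective rho.
  by exists (rho \o rho) => -[[] []].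
have iter_bij : bijective (fun p => (iter m rho p.1, iter m rho p.2)).
  have [r r1 r2] : bijective (iter m rho).
    by elim: (m : nat) => [|n IH] /=; [exists id|apply: bij_comp].
  by exists (fun p => (r p.1, r p.2)) => -[p q] /=; rewrite ?r1 ?r2.
rewrite (reindex _ (onW_bij _ iter_bij)) /=; apply: eq_bigr => -[x y] _.
rewrite /vchar2 /= !(vcharJ _ _ tE); congr (_ * _).
by elim: (m : nat) => //= n IH; rewrite klein_cocycle_rho.
Qed.

Lemma A4_twist_sqr : A4_twist * A4_twist = 1.
Proof.
have sF := A4_twist_supported; apply: vchar2_inj => [||x y].
- exact: supportedM.
- exact: (@supported1 k _ V2group).
rewrite (functionalM (H := V2group)); [|exact: vchar2M|exact: sF].
rewrite vchar2_A4_twist klein_cocycle_sqr -gbasis1 functional_basis.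
by rewrite /vchar2 /= !vchar1 mulr1.
Qed.

Lemma A4_twist_is_twist : is_twist A4_twist.
Proof.
apply/is_twistP; split.
  by apply/unitrP; exists A4_twist; rewrite A4_twist_sqr.
apply/(twist_vchar2 A4_twist_supported) => x y z.
by rewrite !vchar2_A4_twist klein_cocycleP.
Qed.

Lemma A4_twist_not_coboundary a : A4_twist <> delta1_fun a.
Proof.
move=> FE; have := delta1_symmetric a; rewrite -FE => Fsym.
(* At this pair and its flip [klein_cocycle] takes the values -1 and 1. *)
have : functional (vchar2 ((true, false), (false, true))) A4_twist =
    functional (vchar2 ((false, true), (true, false))) A4_twist.
  have sw_bij : bijective (fun p : gT * gT => (p.2, p.1)).
    by exists (fun p => (p.2, p.1)) => -[].
  rewrite !functionalE (reindex _ (onW_bij _ sw_bij)) /=.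
  apply: eq_bigr => -[g h] _; rewrite Fsym /vchar2 /=; congr (_ * _).
  by rewrite mulrC.
rewrite !vchar2_A4_twist /klein_cocycle /= => /eqP.
by rewrite eq_sym -subr_eq0 opprK (_ : 1 + 1 = 2%:R) ?(negPf two_neq0).
Qed.

(** Restricted to V, the linear characters become trivial and the three-dimensional representation
    becomes the sum of the three nontrivial characters. *)
Lemma vchar_cent x t : functional (vchar x) (cent t 1 1 1) =
  if x == k0 then 1 else t.
Proof.
have four_neq0 : 4%:R != 0 :> k by rewrite -[4%N]/(2 * 2)%N natrM mulf_neq0.
rewrite functionalE vchar_sum klein_sum.
(* Each of the three idempotents has coefficient 1/12 on V, which adds up to 1/4. *)
have vE a : gcoef (cent t 1 1 1) (v a) = t * (a == k0)%:R + (1 - t) / 4%:R.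
  rewrite /cent !(gcoefD, gcoefZ) -gbasis1 gcoef_basis -(v0 vD) (inj_eq v_inj).
  rewrite /eps !gcoef_idem /chi (vV vD) omega_v !expr1n.
  have := order_neq0; rewrite card12 => twelve_neq0.
  by field; rewrite four_neq0.
rewrite !vE.
by case: x => [[] []]; rewrite /klein_pair /=; field.
Qed.

(** Outside V the value [y] of [omega] is a cube root of unity other than 1, so the three
    idempotents contribute a multiple of [1 + y + y ^+ 2 = 0]. *)
Lemma cent_supported t : supported Vgroup (cent t 1 1 1).
Proof.
move=> g gV; have g1 : g != 1%g by apply: contra gV => /eqP->; apply: group1.
rewrite /cent !(gcoefD, gcoefZ) -gbasis1 gcoef_basis (negPf g1) mulr0 add0r.
rewrite /eps !gcoef_idem /chi expr0 expr1.
set y := omega (g^-1)%g.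
have y1 : y - 1 != 0.
  rewrite subr_eq0; apply: contra gV => /eqP/omega_eq1[a ga].
  by rewrite -[g]invgK ga groupV; apply: v_in.
have y3 : 1 + y + y ^+ 2 = 0.
  apply: (mulfI y1); rewrite mulr0; transitivity (y ^+ 3 - 1); first by ring.
  by rewrite omega_cube subrr.
transitivity ((1 - t) * #|gT|%:R^-1 * (1 + y + y ^+ 2)); first by ring.
by rewrite y3 mulr0.
Qed.

Lemma vchar2_tensor x y (a b : galg k gT) :
  functional (vchar2 (x, y)) (tensor a b) =
  functional (vchar x) a * functional (vchar y) b.
Proof.
rewrite !functionalE big_distrlr /= pair_bigA; apply: eq_bigr => p _.
by rewrite gcoef_tensor /vchar2 /= mulrACA.
Qed.

Lemma vchar2_coproduct x y (a : galg k gT) :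
  functional (vchar2 (x, y)) (coproduct a) = functional (vchar (kadd x y)) a.
Proof.
apply: (linear_ext (V := k^o)
  (f1 := functional (vchar2 (x, y)) \o @coproduct k gT)
  (f2 := functional (vchar (kadd x y)))) => g.
by rewrite /= coproduct_basis !functional_basis vcharD.
Qed.

(** On V the function [vchar k0] is constantly 1, like [chi 0], and the support of [F] hides their
    difference elsewhere. *)
Lemma twist_evl0 F y : supported V2group F ->
  functional (vchar2 (k0, y)) F = functional (vchar y) (evl (chi 0) F).
Proof.
move=> sF; transitivity (functional (fun p : gT * gT => vchar y p.2) F).
  rewrite !functionalE; apply: eq_bigr => -[g h] _.
  have [ghV|ghV] := boolP ((g, h) \in V2group); last by rewrite sF // !mul0r.
  case/setXP: ghV => /imsetP[a _ /= ->] _; rewrite /vchar2 /= vchar_v.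
  by rewrite klein_pairC klein_pair0 mul1r.
apply: (linear_ext (V := k^o) (f1 := functional (fun p => vchar y p.2))
  (f2 := functional (vchar y) \o evl (chi 0))) => g.
rewrite /= functional_basis /evl glift_basis functionalZ functional_basis.
by rewrite /chi expr0 mul1r.
Qed.

(** * Classification of invariant twists up to coboundaries *)

Lemma twist_supported_classification F :
    is_twist F -> is_invariant F -> supported V2group F -> evl (chi 0) F = 1 ->
  exists a : A1 k gT, F * delta1_fun (A1_val a) = 1 \/
    F * delta1_fun (A1_val a) = A4_twist.
Proof.
move=> tF iF sF F1; pose f x y := functional (vchar2 (x, y)) F.
have uF : F \is a GRing.unit by case: tF.
have f_neq0 x y : f x y != 0.
  apply/eqP => f0.
  have := @functionalM k _ V2group (vchar2 (x, y)) F F^-1 (vchar2M (x, y)) sF.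
  rewrite -/(f x y) f0 mul0r divrr // -gbasis1 functional_basis /vchar2 /=.
  by rewrite !vchar1 mulr1 => /eqP; rewrite oner_eq0.
have fl y : f k0 y = 1.
  by rewrite /f twist_evl0 // F1 -gbasis1 functional_basis vchar1.
have frho x y : f (rho x) (rho y) = f x y.
  by apply: (vchar2J (m := 1) x y iF (a := k0)); rewrite (v0 vD) mul1g.
have fM x y z : f x y * f (kadd x y) z = f y z * f x (kadd y z).
  by have [_ /(twist_vchar2 sF)->] := tF.
have [t t0 ft] := klein_cocycle_classification f_neq0 fl frho fM.
(* The cochain [mu] is the Fourier transform on V of the central unit [cent t 1 1 1], so changing
   the cocycle by [mu] is multiplying [F] by a coboundary. *)
have [ua aV] := centV t0 (oner_neq0 k) (oner_neq0 k) (oner_neq0 k).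
have ca := cent_central t 1 1 1.
have Ha : `[< cent t 1 1 1 \is a GRing.unit /\ is_central (cent t 1 1 1) >].
  exact/asboolP.
exists (MkA1 Ha) => /=; set a := cent t 1 1 1 in ua aV ca Ha *.
have saa : supported V2group (tensor a a).
  move=> [g h] ghV; rewrite gcoef_tensor /=.
  have [gV|gV] := boolP (g \in Vgroup); last by rewrite cent_supported // mul0r.
  have [hV|hV] := boolP (h \in Vgroup); last first.
    by rewrite (cent_supported _ hV) mulr0.
  by case/negP: ghV; apply/setXP.
have aV1 : a^-1 = cent t^-1 1 1 1 by rewrite aV invr1.
have sD : supported V2group (coproduct a^-1).
  have sV : supported Vgroup a^-1 by rewrite aV1; apply: cent_supported.
  move=> p pV; rewrite [a^-1]galg_sum linear_sum gcoef_sum big1 // => g _.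
  rewrite linearZ gcoefZ /= coproduct_basis gcoef_basis.
  have [gV|gV] := boolP (g \in Vgroup); last by rewrite sV // mul0r.
  by case: eqP pV => [->|_]; rewrite ?mulr0 //; case/negP; apply/setXP.
have sFd : supported V2group (F * delta1_fun a).
  by apply: supportedM => //; apply: supportedM.
have fd x y : functional (vchar2 (x, y)) (F * delta1_fun a) = f x y *
    ((if x == k0 then 1 else t) * (if y == k0 then 1 else t) *
     (if kadd x y == k0 then 1 else t)^-1).
  rewrite (functionalM _ (vchar2M (x, y)) sF).
  rewrite (functionalM _ (vchar2M (x, y)) saa).
  rewrite vchar2_tensor vchar2_coproduct aV1 !vchar_cent.
  by congr (_ * (_ * _)); case: ifP => // _; rewrite invr1.
case: ft => ft; [left|right]; apply: vchar2_inj => // [|x y].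
- exact: (@supported1 k _ V2group).
- by rewrite fd ft -gbasis1 functional_basis /vchar2 /= !vchar1 mulr1.
- exact: A4_twist_supported.
- by rewrite fd ft vchar2_A4_twist.
Qed.

Lemma Z2_classification (F : Z2 k gT) :
  exists a : A1 k gT, Z2_val (F * delta1 a)%g = 1 \/
    Z2_val (F * delta1 a)%g = A4_twist.
Proof.
have [tF iF] := Z2P F; have [a [e0 e1]] := twist_normalize tF iF.
have [tFa iFa] := Z2P (F * delta1 a)%g.
have sFa : supported V2group (Z2_val (F * delta1 a)%g).
  move=> [g h] ghV; apply: contraNeq ghV => Fgh.
  have [/omega_eq1[x ->] /omega_eq1[y ->]] := twist_supported tFa iFa e1 Fgh.
  by apply/setXP; split; apply: v_in.
have [b ab] := twist_supported_classification tFa iFa sFa e0.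
by exists (a * b)%g; rewrite delta1M mulgA.
Qed.

Lemma H2_two_classes : exists x y : H2 k gT, x <> y /\ forall z, z = x \/ z = y.
Proof.
have HF : `[< is_twist A4_twist /\ is_invariant A4_twist >].
  by apply/asboolP; split; [apply: A4_twist_is_twist|apply: A4_twist_invariant].
exists (H2_class 1%g), (H2_class (MkZ2 HF)); split.
  move/H2_classP => [a /(congr1 (@Z2_val k gT))] /=.
  by rewrite mul1r; apply: A4_twist_not_coboundary.
elim/H2_ind => F; have [a [aF|aF]] := Z2_classification F.
  by left; apply/H2_classP; exists a; apply/val_inj/esym.
by right; apply/H2_classP; exists a; apply/val_inj/esym.
Qed.

End A4Twists.

(** * The alternating group on four letters *)

Section AlternatingGroup.
Local Open Scope group_scope.
Local Notation A4 := ('Alt_('I_4)).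

(** The binary digits make the four letters an affine plane over the field of two elements; V acts
    by translations and [c] by a linear map. *)
Definition klein_of (i : 'I_4) : klein := (odd i, (1 < i)%N).
Definition of_klein (a : klein) : 'I_4 := inord (a.1 + a.2.*2)%N.

Lemma of_kleinK : cancel of_klein klein_of.
Proof. by case=> [[] []]; rewrite /klein_of /of_klein !inordK. Qed.

Lemma klein_ofK : cancel klein_of of_klein.
Proof.
move=> i; apply: val_inj; rewrite /of_klein /klein_of /= inordK;
by case: i => [[|[|[|[|]]]]].
Qed.

Lemma translation_inj a : injective (fun i => of_klein (kadd a (klein_of i))).
Proof.
apply: (can_inj (g := fun i => of_klein (kadd a (klein_of i)))) => i.
rewrite of_kleinK -[RHS]klein_ofK; congr of_klein.
by case: a (klein_of i) => [[] []] [[] []].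
Qed.

(* The inverse of [rho], because permutations multiply from left to right. *)
Lemma rotation_inj : injective (fun i => of_klein (rho (rho (klein_of i)))).
Proof.
apply: (can_inj (g := fun i => of_klein (rho (klein_of i)))) => i.
rewrite of_kleinK -[RHS]klein_ofK; congr of_klein.
by case: (klein_of i) => [[] []].
Qed.

Definition translation a : {perm 'I_4} := perm (@translation_inj a).
Definition rotation : {perm 'I_4} := perm rotation_inj.

Lemma translationD a b : translation (kadd a b) = translation a * translation b.
Proof.
apply/permP => i; rewrite permM !permE of_kleinK; congr of_klein.
by case: a b (klein_of i) => [[] []] [[] []] [[] []].
Qed.

Lemma translation_inj_l : injective translation.
Proof.
move=> a b /permP/(_ (of_klein k0)); rewrite !permE !of_kleinK.
move/(can_inj of_kleinK); by case: a b => [[] []] [[] []].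
Qed.

Lemma rotation_translation a :
  rotation * translation a = translation (rho a) * rotation.
Proof.
apply/permP => i; rewrite !permM !permE !of_kleinK; congr of_klein.
by case: a (klein_of i) => [[] []] [[] []].
Qed.

Lemma rotation_cube : rotation ^+ 3 = 1.
Proof.
apply/permP => i; rewrite !expgS expg0 mulg1 !permM !permE !of_kleinK.
by rewrite -[RHS]klein_ofK; congr of_klein; case: (klein_of i) => [[] []].
Qed.

(** By [rotation_cube] the rotation is its own fourth power, a product of an even number of equal
    factors. *)
Lemma rotation_Alt : rotation \in A4.
Proof.
rewrite Alt_even -[rotation]mul1g -rotation_cube !expgS expg0 mulg1.
by rewrite !odd_permM; case: (odd_perm rotation).
Qed.

(** Translations by [b] and [rho b] are conjugate, hence of equal parity, and every translation is a
    product of two such. *)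
Lemma translation_Alt a : translation a \in A4.
Proof.
have odd_rho b : odd_perm (translation (rho b)) = odd_perm (translation b).
  have := congr1 (@odd_perm 'I_4) (rotation_translation b); rewrite !odd_permM.
  by rewrite addbC => /addIb.
have -> : a = kadd (rho a) (rho (rho a)) by case: a => [[] []].
by rewrite Alt_even translationD odd_permM !odd_rho addbb.
Qed.

Definition A4_translation a := subg A4 (translation a).
Definition A4_rotation := subg A4 rotation.

Lemma A4_translationD a b :
  A4_translation (kadd a b) = A4_translation a * A4_translation b.
Proof. by rewrite /A4_translation translationD subgM ?translation_Alt. Qed.

Lemma A4_translation_inj : injective A4_translation.
Proof.
move=> a b /(congr1 sgval); rewrite !subgK ?translation_Alt //.
exact: translation_inj_l.
Qed.

Lemma A4_rotation_translation a :
  A4_rotation * A4_translation a = A4_translation (rho a) * A4_rotation.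
Proof.
by rewrite -!subgM ?translation_Alt ?rotation_Alt // rotation_translation.
Qed.

Lemma A4_rotation_cube : A4_rotation ^+ 3 = 1.
Proof.
rewrite !expgS expg0 mulg1 -!subgM ?groupM ?rotation_Alt //.
have := rotation_cube; rewrite !expgS expg0 mulg1 => ->.
by apply: val_inj; rewrite /= subgK ?group1.
Qed.

Lemma card_A4 : #|{: [subg A4]}| = 12.
Proof.
(* The known formula [card_Alt] gives twice the order, namely 4!. *)
rewrite card_sub; apply: double_inj; rewrite -mul2n.
by rewrite (eq_card (B := mem 'Alt_('I_4))) // card_Alt card_ord.
Qed.

End AlternatingGroup.

(** * The base field, and the count of classes *)

Lemma pchar0_natr_neq0 (k : fieldType) (p : nat) :
  [pchar k]%R =i pred0 -> prime p -> (p%:R != 0 :> k)%R.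
Proof.
move=> char0 p_prime; apply/negP => p0.
by have := char0 p; rewrite !inE p_prime p0.
Qed.

Lemma closed_field_cube_root (k : closedFieldType) :
  exists zeta : k, (zeta ^+ 2 + zeta + 1 = 0)%R.
Proof.
(* With all lower coefficients -1 the equation solved is [z ^+ 2 = - 1 - z]. *)
have [z zE] := @solve_monicpoly k 2 (fun=> (- 1)%R) isT.
exists z; rewrite zE !big_ord_recl big_ord0 /bump /= expr0 expr1.
by ring.
Qed.

Local Open Scope classical_set_scope.
Local Open Scope card_scope.

Lemma card_two_elements (T : Type) (x y : T) :
  x <> y -> (forall z, z = x \/ z = y) -> [set: T] #= `I_2.
Proof.
move=> xy xyP; pose f n := if n is 0 then x else y.
have -> : [set: T] = f @` `I_2.
  by apply/seteqP; split=> // z _; case: (xyP z) => ->; [exists 0|exists 1].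
apply: inj_card_eq => -[|[|m]] [|[|n]]; rewrite !inE //= => _ _ e.
all: by case: xy.
Qed.

Theorem proposition7p7 (k : closedFieldType) (char0 : [pchar k]%R =i pred0) :
  [set: H2 k [subg 'Alt_('I_4)]] #= `I_2.
Proof.
have [zeta zetaE] := closed_field_cube_root k.
have two0 := pchar0_natr_neq0 char0 (isT : prime 2).
have three0 := pchar0_natr_neq0 char0 (isT : prime 3).
have [omega [omegaM omegaE]] := omega_exists A4_translationD A4_translation_inj
  A4_rotation_cube A4_rotation_translation card_A4 (zeta3 zetaE).
have [x [y [xy xyP]]] := H2_two_classes A4_translationD A4_translation_inj
  A4_rotation_translation card_A4 zetaE two0 three0 omegaM omegaE.
exact: card_two_elements xy xyP.
Qed.
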